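(* Let $(X,\Sigma_X,\mu)$ be a measure space with $\mu(X)>0$. Let $K$ be a compact Hausdorff abelian group with Pontryagin dual $\hat K$, and let $\iota:K_{\mathcal{B}a}\to\mathbb T^{\hat K}$ be the map $\iota(k):=(\langle\hat k,k\rangle)_{\hat k\in\hat K}$. Then $$\mathrm{Cond}(\iota)(\mathrm{Cond}(K_{\mathcal{B}a}))=\{(\theta_{\hat k})_{\hat k\in\hat K}\in\mathrm{Cond}(\mathbb T)^{\hat K}:\ \theta_{\hat k_1+\hat k_2}=\theta_{\hat k_1}+\theta_{\hat k_2}\ \ \forall\,\hat k_1,\hat k_2\in\hat K\},$$ where $\mathrm{Cond}(\mathbb T^{\hat K})$ is identified with $\mathrm{Cond}(\mathbb T)^{\hat K}$ via $f\mapsto(\pi_{\hat k}\circ f)_{\hat k\in\hat K}$. Moreover, $\mathrm{Cond}(\iota):\mathrm{Cond}(K_{\mathcal{B}a})\to\mathrm{Cond}(\mathbb T^{\hat K})$ is injective.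
   Context: The measure algebra of $(X,\Sigma_X,\mu)$ is the $\sigma$-complete Boolean algebra $X_\mu:=\Sigma_X/\mathcal N_\mu$, where $\mathcal N_\mu$ is the $\sigma$-ideal of $\mu$-null sets. For a measurable space $(Y,\Sigma_Y)$, $\mathrm{Cond}(Y)$ is the set of conditional elements of $Y$: formal objects $y$ given by a pullback map $y^*:\Sigma_Y\to X_\mu$ that is a Boolean algebra homomorphism preserving countable joins. If $f:Y\to Z$ is measurable, $\mathrm{Cond}(f):\mathrm{Cond}(Y)\to\mathrm{Cond}(Z)$ is $y\mapsto f\circ y$, where $(f\circ y)^*(E):=y^*(f^{-1}(E))$ for $E\in\Sigma_Z$. For a compact space $K$, $K_{\mathcal{B}a}=(K,\mathcal{B}a(K))$, where $\mathcal{B}a(K)$ is the $\sigma$-algebra generated by all continuous maps $K\to\mathbb R$. $\mathbb T=\mathbb R/\mathbb Z$ has its Borel $\sigma$-algebra and $\mathbb T^{\hat K}$ the product $\sigma$-algebra; $\pi_{\hat k}$ denotes the coordinate projections. $\hat K$ is the group of continuous homomorphisms $\hat k: K\to\mathbb T$, written $k\mapsto\langle\hat k,k\rangle$. For any family of Polish spaces $(S_\alpha)_{\alpha \in A}$, the map $f\mapsto(\pi_\alpha\circ f)_\alpha$ is a bijection $\mathrm{Cond}(\prod_\alpha S_\alpha)\to\prod_\alpha\mathrm{Cond}(S_\alpha)$ (product $\sigma$-algebra); this is the identification used. Addition on $\mathrm{Cond}(\mathbb T)$ is $\theta+\theta':=\mathrm{Cond}(+)(\theta,\theta')$, where $(\theta,\theta')$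 is viewed as an element of $\mathrm{Cond}(\mathbb T^2)$ via this identification and $+:\mathbb T^2\to\mathbb T$ is the usual addition. *)

(* Defs.v *)
From HB Require Import structures.
From mathcomp Require Import all_boot all_order all_algebra.
From mathcomp Require Import generic_quotient ring_quotient.
From mathcomp Require Import ring lra zify.
From mathcomp Require Import all_classical all_reals all_analysis.
From mathcomp Require Import measurable_realfun.

Set Implicit Arguments.
Unset Strict Implicit.
Unset Printing Implicit Defensive.
Import Order.TTheory GRing.Theory Num.Theory.
Import numFieldNormedType.Exports.
Local Open Scope classical_set_scope.
Local Open Scope ring_scope.

(* The sigma-algebra Sigma_Y as a type. *)
Record msets (d : measure_display) (Y : measurableType d) :=
  MSet { mset_set :> set Y ; mset_measurable : measurable mset_set }.

HB.instance Definition _ d (Y : measurableType d) := gen_eqMixin (msets Y).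
HB.instance Definition _ d (Y : measurableType d) := gen_choiceMixin (msets Y).

Section msets_theory.
Context {d : measure_display} {Y : measurableType d}.
Implicit Types A B : msets Y.

Lemma mset_inj : injective (@mset_set d Y).
Proof.
move=> [A mA] [B mB] /= AB; subst B; congr MSet; exact: Prop_irrelevance.
Qed.

Definition mset0 : msets Y := MSet measurable0.
Definition msetT : msets Y := MSet measurableT.
Definition msetI A B : msets Y :=
  MSet (measurableI _ _ (mset_measurable A) (mset_measurable B)).
Definition msetU A B : msets Y :=
  MSet (measurableU _ _ (mset_measurable A) (mset_measurable B)).
Definition msetC A : msets Y := MSet (measurableC (mset_measurable A)).
Definition mset_bigcup (A : nat -> msets Y) : msets Y :=
  MSet (bigcup_measurable (P := setT) (fun k _ => mset_measurable (A k))).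

End msets_theory.

Section measure_algebra.
Context {R : realType} {d : measure_display} {X : measurableType d}.
Variable mu : {measure set X -> \bar R}.
Implicit Types A B C : msets X.

Definition null_equiv A B : bool := `[< mu (A `+` B) = 0%E >].

Lemma null_equivP A B : null_equiv A B <->
  exists N : set X, [/\ measurable N, mu N = 0%E &
    forall x, ~ N x -> ((A : set X) x <-> (B : set X) x)].
Proof.
have mAB : measurable (A `+` B) by apply: measurableU; apply: measurableD; exact: mset_measurable.
split=> [/asboolP AB0|[N [mN N0 NAB]]].
- exists (A `+` B); split => // x; rewrite /setY /setU /= => /not_orP[nAB nBA].
  by split=> [Ax|Bx]; apply: contrapT => ?; [apply: nAB|apply: nBA].
- apply/asboolP/eqP; rewrite eq_le measure_ge0 andbT -N0 le_measure ?inE//.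
  move=> x ABx; apply: contrapT => /NAB ABE.
  by case: ABx => -[? []]; apply/ABE.
Qed.

Lemma null_equiv_refl : reflexive null_equiv.
Proof. by move=> A; apply/asboolP; rewrite /setY !setDv setU0 measure0. Qed.

Lemma null_equiv_sym : symmetric null_equiv.
Proof. by move=> A B; rewrite /null_equiv setYC. Qed.

Lemma null_equiv_trans : transitive null_equiv.
Proof.
move=> B A C /null_equivP[N [mN N0 AB]] /null_equivP[M [mM M0 BC]].
apply/null_equivP; exists (N `|` M); split.
- exact: measurableU.
- by rewrite null_set_setU.
- by move=> x /not_orP[nN nM]; split=> [/AB/BC|/BC/AB]; apply.
Qed.

Canonical null_equiv_equiv :=
  EquivRel null_equiv null_equiv_refl null_equiv_sym null_equiv_trans.
Canonical null_equiv_encModRel := defaultEncModRel null_equiv.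

Local Open Scope quotient_scope.

(* The measure algebra X_mu = Sigma_X / N_mu: two measurable sets are identified
   when their symmetric difference is mu-null. No finiteness, sigma-finiteness
   or completeness of mu is assumed. *)
Definition malg : Type := {eq_quot null_equiv}.

HB.instance Definition _ : EqQuotient _ null_equiv malg :=
  EqQuotient.on malg.
HB.instance Definition _ := Choice.on malg.

Definition mcls (A : msets X) : malg := \pi_malg A.

Lemma mclsP A B : mcls A = mcls B <-> null_equiv A B.
Proof. by split=> [/eqmodP|?]; last exact/eqmodP. Qed.

Lemma mcls_ind (P : malg -> Prop) : (forall A, P (mcls A)) -> forall a, P a.
Proof. by move=> PA a; rewrite -[a]reprK; exact: PA. Qed.

Definition malg_meet (a b : malg) : malg := mcls (msetI (repr a) (repr b)).
Definition malg_join (a b : malg) : malg := mcls (msetU (repr a) (repr b)).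
Definition malg_compl (a : malg) : malg := mcls (msetC (repr a)).

Lemma repr_mcls A : null_equiv (repr (mcls A)) A.
Proof. by apply/mclsP; rewrite /mcls reprK. Qed.

Lemma mclsI A B : mcls (msetI A B) = malg_meet (mcls A) (mcls B).
Proof.
apply/esym/mclsP/null_equivP.
have /null_equivP[N [mN N0 NA]] := repr_mcls A.
have /null_equivP[M [mM M0 MB]] := repr_mcls B.
exists (N `|` M); split; [exact: measurableU|by rewrite null_set_setU|].
by move=> x /not_orP[/NA NAx /MB MBx]; split=> -[] /NAx ? /MBx.
Qed.

Lemma mclsU A B : mcls (msetU A B) = malg_join (mcls A) (mcls B).
Proof.
apply/esym/mclsP/null_equivP.
have /null_equivP[N [mN N0 NA]] := repr_mcls A.
have /null_equivP[M [mM M0 MB]] := repr_mcls B.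
exists (N `|` M); split; [exact: measurableU|by rewrite null_set_setU|].
by move=> x /not_orP[/NA NAx /MB MBx]; split=> -[/NAx|/MBx] ?; by [left|right].
Qed.

Lemma mclsC A : mcls (msetC A) = malg_compl (mcls A).
Proof.
apply/esym/mclsP/null_equivP.
have /null_equivP[N [mN N0 NA]] := repr_mcls A.
by exists N; split=> // x /NA NAx; split=> nA /NAx.
Qed.

Lemma malg_meetC : commutative malg_meet.
Proof.
elim/mcls_ind => A; elim/mcls_ind => B; rewrite -!mclsI.
by congr mcls; apply: mset_inj => /=; rewrite setIC.
Qed.

Lemma malg_joinC : commutative malg_join.
Proof.
elim/mcls_ind => A; elim/mcls_ind => B; rewrite -!mclsU.
by congr mcls; apply: mset_inj => /=; rewrite setUC.
Qed.

Lemma malg_meetA : associative malg_meet.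
Proof.
elim/mcls_ind => A; elim/mcls_ind => B; elim/mcls_ind => C.
by rewrite -!mclsI; congr mcls; apply: mset_inj => /=; rewrite setIA.
Qed.

Lemma malg_joinA : associative malg_join.
Proof.
elim/mcls_ind => A; elim/mcls_ind => B; elim/mcls_ind => C.
by rewrite -!mclsU; congr mcls; apply: mset_inj => /=; rewrite setUA.
Qed.

Lemma malg_joinKI b a : malg_meet a (malg_join a b) = a.
Proof.
elim/mcls_ind: a => A; elim/mcls_ind: b => B.
by rewrite -mclsU -mclsI; congr mcls; apply: mset_inj => /=; rewrite setUC setKU.
Qed.

Lemma malg_meetKU b a : malg_join a (malg_meet a b) = a.
Proof.
elim/mcls_ind: a => A; elim/mcls_ind: b => B.
by rewrite -mclsI -mclsU; congr mcls; apply: mset_inj => /=; rewrite setIC setKI.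
Qed.

Lemma malg_meetUl : left_distributive malg_meet malg_join.
Proof.
elim/mcls_ind => A; elim/mcls_ind => B; elim/mcls_ind => C.
rewrite -mclsU -!mclsI -mclsU.
by congr mcls; apply: mset_inj => /=; rewrite setIUl.
Qed.

Lemma malg_meetxx : idempotent_op malg_meet.
Proof.
elim/mcls_ind => A.
by rewrite -mclsI; congr mcls; apply: mset_inj => /=; rewrite setIid.
Qed.

Definition malg_le (a b : malg) := malg_meet a b == a.
Definition malg_lt (a b : malg) := (b != a) && malg_le a b.

Fact malg_display : Order.disp_t. Proof. by []. Qed.

HB.instance Definition _ := Order.isMeetJoinDistrLattice.Build malg_display malg
  (le := malg_le) (lt := malg_lt) (fun _ _ => erefl) (fun _ _ => erefl)
  malg_meetC malg_joinC malg_meetA malg_joinA malg_joinKI malg_meetKU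
  malg_meetUl malg_meetxx.

Lemma malg_le0x (a : malg) : (mcls mset0 <= a)%O.
Proof.
elim/mcls_ind: a => A; apply/eqP.
by rewrite -mclsI; congr mcls; apply: mset_inj => /=; rewrite set0I.
Qed.

Lemma malg_lex1 (a : malg) : (a <= mcls msetT)%O.
Proof.
elim/mcls_ind: a => A; apply/eqP.
by rewrite -mclsI; congr mcls; apply: mset_inj => /=; rewrite setIT.
Qed.

HB.instance Definition _ := Order.hasBottom.Build malg_display malg malg_le0x.
HB.instance Definition _ := Order.hasTop.Build malg_display malg malg_lex1.

Lemma malg_joinxC (a : malg) : Order.join a (malg_compl a) = \top%O.
Proof.
elim/mcls_ind: a => A; rewrite -mclsC -[LHS]mclsU.
by congr mcls; apply: mset_inj => /=; rewrite setUv.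
Qed.

Lemma malg_meetxC (a : malg) : Order.meet a (malg_compl a) = \bot%O.
Proof.
elim/mcls_ind: a => A; rewrite -mclsC -[LHS]mclsI.
by congr mcls; apply: mset_inj => /=; rewrite setICr.
Qed.

HB.instance Definition _ := Order.TBDistrLattice_hasComplement.Build
  malg_display malg malg_joinxC malg_meetxC.

Lemma mcls_le A B : (mcls A <= mcls B)%O <-> mu (A `\` B) = 0%E.
Proof.
have mAB : measurable (A `\` B) by apply: measurableD; exact: mset_measurable.
rewrite -[(_ <= _)%O]/(malg_meet (mcls A) (mcls B) == mcls A) -mclsI.
split=> [/eqP/mclsP/null_equivP[N [mN N0 NAB]]|AB0].
- apply/eqP; rewrite eq_le measure_ge0 andbT -N0 le_measure ?inE//.
  by move=> x [Ax Bx]; apply: contrapT => /NAB /= [_ /(_ Ax)[]].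
- apply/eqP/mclsP/null_equivP; exists (A `\` B); split=> // x.
  by move=> /not_andP[]nABx; split=> [[]|Ax] //; split=> //; apply: contrapT.
Qed.

Lemma mcls_bigcup (A : nat -> msets X) :
  supremums (range (fun n => mcls (A n))) (mcls (mset_bigcup A)).
Proof.
split=> [_ [n _ <-]|b].
  apply/mcls_le; rewrite (_ : _ `\` _ = set0) ?measure0//.
  by rewrite -subset0 => x [Ax]; apply; exists n.
elim/mcls_ind: b => B ubB; apply/mcls_le.
have AB0 n : mu (A n `\` B) = 0%E by apply/mcls_le/ubB; exists n.
rewrite /= setDE setI_bigcupl.
have mAB n : measurable (A n `&` ~` B).
  by rewrite -setDE; apply: measurableD; exact: mset_measurable.
have mcup : measurable (\bigcup_n (A n `&` ~` B)) by exact: bigcup_measurable.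
apply/negligibleP => //; apply: negligible_bigcup => n.
by apply/negligibleP => //; rewrite -[RHS](AB0 n) setDE.
Qed.

(* Countable joins in X_mu are suprema for its order (cf. pullback_bigcup). *)
Lemma malg_sigma_complete (a : nat -> malg) : supremums (range a) !=set0.
Proof.
exists (mcls (mset_bigcup (fun n => repr (a n)))).
rewrite [X in supremums (range X)](_ : a = fun n => mcls (repr (a n))).
  exact: mcls_bigcup.
by apply/funext => n; rewrite /mcls reprK.
Qed.

End measure_algebra.

Section conditional_elements.
Context {R : realType} {d : measure_display} {X : measurableType d}.
Variable mu : {measure set X -> \bar R}.

(* Cond(Y) *)
Record cond (d' : measure_display) (Y : measurableType d') := Cond {
  pullback :> msets Y -> malg mu ;
  pullback0 : pullback mset0 = \bot%O ;
  pullbackT : pullback msetT = \top%O ;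
  pullbackI : forall E F,
    pullback (msetI E F) = Order.meet (pullback E) (pullback F) ;
  pullbackU : forall E F,
    pullback (msetU E F) = Order.join (pullback E) (pullback F) ;
  pullbackC : forall E, pullback (msetC E) = Order.compl (pullback E) ;
  pullback_bigcup : forall E : nat -> msets Y,
    supremums (range (fun n => pullback (E n))) (pullback (mset_bigcup E)) }.

Lemma cond_eq d' (Y : measurableType d') (y z : cond Y) :
  pullback y = pullback z -> y = z.
Proof.
case: y z => [f f0 fT fI fU fC fS] [g g0 gT gI gU gC gS] /= fg; subst g.
by congr Cond; exact: Prop_irrelevance.
Qed.

Section cond_map.
Context {d1 d2 : measure_display}.
Context {Y : measurableType d1} {Z : measurableType d2}.
Variable f : {mfun Y >-> Z}.

Definition mset_preimage (E : msets Z) : msets Y :=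
  MSet (measurable_funPTI f (mset_measurable E)).

Variable y : cond Y.

Definition cond_map_pullback (E : msets Z) : malg mu := y (mset_preimage E).

Lemma cond_map_pullback0 : cond_map_pullback mset0 = \bot%O.
Proof. by rewrite -(pullback0 y); congr (y _); exact: mset_inj. Qed.

Lemma cond_map_pullbackT : cond_map_pullback msetT = \top%O.
Proof. by rewrite -(pullbackT y); congr (y _); exact: mset_inj. Qed.

Lemma cond_map_pullbackI E F : cond_map_pullback (msetI E F) =
  Order.meet (cond_map_pullback E) (cond_map_pullback F).
Proof. by rewrite -(pullbackI y); congr (y _); exact: mset_inj. Qed.

Lemma cond_map_pullbackU E F : cond_map_pullback (msetU E F) =
  Order.join (cond_map_pullback E) (cond_map_pullback F).
Proof. by rewrite -(pullbackU y); congr (y _); exact: mset_inj. Qed.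

Lemma cond_map_pullbackC E :
  cond_map_pullback (msetC E) = Order.compl (cond_map_pullback E).
Proof. by rewrite -(pullbackC y); congr (y _); exact: mset_inj. Qed.

Lemma cond_map_pullback_bigcup (E : nat -> msets Z) :
  supremums (range (fun n => cond_map_pullback (E n)))
    (cond_map_pullback (mset_bigcup E)).
Proof.
have := pullback_bigcup y (fun n => mset_preimage (E n)).
by rewrite (_ : mset_bigcup _ = mset_preimage (mset_bigcup E));
  last exact: mset_inj.
Qed.

(* Cond(f) y = f o y *)
Definition cond_map : cond Z :=
  Cond cond_map_pullback0 cond_map_pullbackT cond_map_pullbackI
    cond_map_pullbackU cond_map_pullbackC cond_map_pullback_bigcup.

End cond_map.

(* The conditional element E |-> [f^-1 E] induced by a measurable f : X -> Y. *)
Section cond_of.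
Context {d1 : measure_display} {Y : measurableType d1}.
Variable f : {mfun X >-> Y}.

Definition cond_of_pullback (E : msets Y) : malg mu :=
  mcls mu (mset_preimage f E).

Lemma cond_of_pullback0 : cond_of_pullback mset0 = \bot%O.
Proof. by congr mcls; exact: mset_inj. Qed.

Lemma cond_of_pullbackT : cond_of_pullback msetT = \top%O.
Proof. by congr mcls; exact: mset_inj. Qed.

Lemma cond_of_pullbackI E F : cond_of_pullback (msetI E F) =
  Order.meet (cond_of_pullback E) (cond_of_pullback F).
Proof. by rewrite -[RHS]mclsI; congr mcls; exact: mset_inj. Qed.

Lemma cond_of_pullbackU E F : cond_of_pullback (msetU E F) =
  Order.join (cond_of_pullback E) (cond_of_pullback F).
Proof. by rewrite -[RHS]mclsU; congr mcls; exact: mset_inj. Qed.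

Lemma cond_of_pullbackC E :
  cond_of_pullback (msetC E) = Order.compl (cond_of_pullback E).
Proof. by rewrite -[RHS]mclsC; congr mcls; exact: mset_inj. Qed.

Lemma cond_of_pullback_bigcup (E : nat -> msets Y) :
  supremums (range (fun n => cond_of_pullback (E n)))
    (cond_of_pullback (mset_bigcup E)).
Proof.
have := mcls_bigcup mu (fun n => mset_preimage f (E n)).
by rewrite (_ : mset_bigcup _ = mset_preimage f (mset_bigcup E));
  last exact: mset_inj.
Qed.

Definition cond_of : cond Y :=
  Cond cond_of_pullback0 cond_of_pullbackT cond_of_pullbackI
    cond_of_pullbackU cond_of_pullbackC cond_of_pullback_bigcup.

End cond_of.

End conditional_elements.

Section circle.
Variable R : realType.

Definition int_pred : {pred R} := fun x => x \is a Num.int.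

Lemma int_pred_zmod_closed : zmod_closed int_pred.
Proof. by split=> [|x y xZ yZ]; [exact: rpred0|exact: rpredB]. Qed.

HB.instance Definition _ := GRing.isZmodClosed.Build R int_pred
  int_pred_zmod_closed.

(* R / Z, with the quotient topology and its Borel sigma-algebra. *)
Definition circle : Type := {ideal_quot int_pred}.

HB.instance Definition _ := GRing.Zmodule.on circle.
HB.instance Definition _ := isPointed.Build circle 0.

Definition circle_pi (x : R) : circle := (\pi_{ideal_quot int_pred} x)%qT.

Definition circle_open (U : set circle) : Prop := open (circle_pi @^-1` U).

Lemma circle_openT : circle_open setT.
Proof. by rewrite /circle_open preimage_setT; exact: openT. Qed.

Lemma circle_openI : setI_closed circle_open.
Proof. by move=> U V oU oV; exact: openI. Qed.

Lemma circle_open_bigU (I : Type) (U : I -> set circle) :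
  (forall i, circle_open (U i)) -> circle_open (\bigcup_i U i).
Proof. by move=> oU; apply: bigcup_open => i _; exact: oU. Qed.

HB.instance Definition _ := isOpenTopological.Build circle
  circle_openT circle_openI circle_open_bigU.

HB.instance Definition _ :=
  Measurable.copy circle (g_sigma_algebraType (@open circle)).

Lemma circle_openE (U : set circle) : open U = open (circle_pi @^-1` U).
Proof. by []. Qed.

Lemma circle_piD x y : circle_pi (x + y) = circle_pi x + circle_pi y.
Proof. by rewrite /circle_pi raddfD. Qed.

Lemma circle_piB x y : circle_pi (x - y) = circle_pi x - circle_pi y.
Proof. by rewrite /circle_pi raddfB. Qed.

Lemma circle_piP x y : circle_pi x = circle_pi y <-> x - y \is a Num.int.
Proof.
rewrite -[x - y \is a _]/(x - y \in int_pred) Quotient.idealrBE.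
by split=> [/eqP|/eqP].
Qed.

Lemma circle_pi_surj (t : circle) : exists x, circle_pi x = t.
Proof. by exists (repr (t : {ideal_quot int_pred})); exact: reprK. Qed.

Lemma circle_pi_continuous : continuous circle_pi.
Proof. exact/continuousP. Qed.

Lemma circle_pi_open (U : set R) : open U -> open (circle_pi @` U).
Proof.
move=> oU; rewrite circle_openE.
rewrite (_ : _ @^-1` _ = \bigcup_(n : int) ((fun x => x + n%:~R) @^-1` U)).
  apply: bigcup_open => n _.
  have /continuousP : continuous (fun x : R => x + n%:~R).
    by move=> x; apply: cvgD; [exact: cvg_id|exact: cvg_cst].
  exact.
apply/seteqP; split=> [x [u Uu /circle_piP /intrP[n uxn]]|x [n _ Uxn]].
  by exists n => //=; rewrite -uxn addrCA subrr addr0.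
by exists (x + n%:~R) => //; apply/circle_piP; rewrite addrAC subrr add0r intr_int.
Qed.

Lemma circle_sub_continuous : continuous (fun x : circle * circle => x.1 - x.2).
Proof.
move=> [s t]; have [x xs] := circle_pi_surj s; have [y yt] := circle_pi_surj t.
subst s t => U /=; rewrite -circle_piB .
rewrite nbhsE => -[V [oV Vxy] VU].
have cont : continuous (fun z : R * R => z.1 - z.2).
  by move=> z; apply: sub_continuous.
have : nbhs (x - y) (circle_pi @^-1` V).
  by apply: open_nbhs_nbhs; split; [rewrite -circle_openE|].
move=> /(cont (x, y)) [[A B] /= [nA nB] AB].
exists (circle_pi @` A^°, circle_pi @` B^°) => /=; last first.
  move=> [_ _] /= [[a Aa <-] [b Bb <-]]; rewrite -circle_piB.
  by apply/VU/(AB (a, b)); split; exact: interior_subset.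
split; apply: open_nbhs_nbhs; split;
  by [exact/circle_pi_open/open_interior|exists x|exists y].
Qed.

HB.instance Definition _ :=
  PreTopologicalNmodule_isTopologicalZmodule.Build circle circle_sub_continuous.
End circle.

Section pontryagin_dual.
Variables (R : realType) (K : topologicalZmodType).

Record pdual := PDual {
  pdual_fun :> K -> circle R ;
  pdual_add : {morph pdual_fun : x y / x + y} ;
  pdual_continuous : continuous pdual_fun }.

HB.instance Definition _ := gen_eqMixin pdual.
HB.instance Definition _ := gen_choiceMixin pdual.

Lemma pdual_eq (k l : pdual) : k =1 l -> k = l.
Proof.
case: k l => [k kD kC] [l lD lC] /= /funext kl; subst l.
by congr PDual; exact: Prop_irrelevance.
Qed.

Lemma pdual_zero_add : {morph (fun=> 0 : circle R) : x y / x + y : K >-> x + y}.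
Proof. by move=> x y; rewrite addr0. Qed.

Lemma pdual_zero_continuous : continuous ((fun=> 0) : K -> circle R).
Proof. exact: cst_continuous. Qed.

Definition pdual_zero := PDual pdual_zero_add pdual_zero_continuous.

Lemma pdual_opp_add (k : pdual) : {morph (fun x => - k x) : x y / x + y}.
Proof. by move=> x y; rewrite pdual_add opprD. Qed.

Lemma pdual_opp_continuous (k : pdual) : continuous (fun x => - k x).
Proof.
move=> x; apply: continuous_comp; first exact: pdual_continuous.
exact: opp_continuous.
Qed.

Definition pdual_opp (k : pdual) :=
  PDual (pdual_opp_add k) (@pdual_opp_continuous k).

Lemma pdual_sum_add (k l : pdual) : {morph (fun x => k x + l x) : x y / x + y}.
Proof. by move=> x y; rewrite !pdual_add addrACA. Qed.

Lemma pdual_sum_continuous (k l : pdual) : continuous (fun x => k x + l x).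
Proof.
move=> x; apply: (@continuous_comp _ _ _ (fun x => (k x, l x))
  (fun z : circle R * circle R => z.1 + z.2)); last exact: add_continuous.
exact: (cvg_pair (@pdual_continuous k x) (@pdual_continuous l x)).
Qed.

Definition pdual_sum (k l : pdual) :=
  PDual (pdual_sum_add k l) (@pdual_sum_continuous k l).

Lemma pdual_sumA : associative pdual_sum.
Proof. by move=> k l m; apply: pdual_eq => x /=; rewrite addrA. Qed.

Lemma pdual_sumC : commutative pdual_sum.
Proof. by move=> k l; apply: pdual_eq => x /=; rewrite addrC. Qed.

Lemma pdual_sum0 : left_id pdual_zero pdual_sum.
Proof. by move=> k; apply: pdual_eq => x /=; rewrite add0r. Qed.

Lemma pdual_sumN : left_inverse pdual_zero pdual_opp pdual_sum.
Proof. by move=> k; apply: pdual_eq => x /=; rewrite addNr. Qed.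

HB.instance Definition _ :=
  GRing.isZmodule.Build pdual pdual_sumA pdual_sumC pdual_sum0 pdual_sumN.

End pontryagin_dual.

Definition baire_generators (R : realType) (T : topologicalType) :
    set (set T) :=
  \bigcup_(f in [set f : T -> R | continuous f])
    preimage_set_system [set: T] f measurable.

(* R is only used to type the continuous functions K -> R that generate the
   sigma-algebra of baire R K. *)
Definition baire (R : realType) (K : topologicalZmodType) : Type := K.

HB.instance Definition _ R K := TopologicalZmodule.on (baire R K).
HB.instance Definition _ R K := isPointed.Build (baire R K) 0.
HB.instance Definition _ R K := Measurable.copy (baire R K)
  (g_sigma_algebraType (@baire_generators R (baire R K))).

Section mpow.
Context {d : measure_display}.
Variables (I : Type) (T : measurableType d).

Definition cylinders : set (set (I -> T)) :=
  \bigcup_(i in [set: I]) preimage_set_system [set: I -> T] (fun f => f i) measurable.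

(* I -> T with the product sigma-algebra, for an arbitrary index type I. *)
Definition mpow : Type := g_sigma_algebraType cylinders.
HB.instance Definition _ := Measurable.on mpow.

Definition mpow_proj (i : I) (f : mpow) : T := f i.

Lemma measurable_mpow_proj i : measurable_fun [set: mpow] (mpow_proj i).
Proof.
by move=> _ B mB; apply: sub_sigma_algebra; exists i => //; exists B.
Qed.
HB.instance Definition _ i :=
  isMeasurableFun.Build _ _ mpow T (mpow_proj i) (measurable_mpow_proj i).
End mpow.

Section circle_measurability.
Variable R : realType.
Local Notation circle := (circle R).
Local Notation circle_pi := (@circle_pi R).

Lemma measurable_circle_pi : measurable_fun [set: R] circle_pi.
Proof.
apply: (measurability (@open circle) erefl) => _ [U oU <-].
by apply: open_measurable; rewrite setTI -circle_openE.
Qed.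

(* The representative in [0, 1[. It only serves to prove measurability of the
   addition of the circle for the product (not the Borel) sigma-algebra of
   circle * circle. *)
Definition circle_frac (t : circle) : R :=
  let x := xget 0 (circle_pi @^-1` [set t]) in x - (Num.floor x)%:~R.

Lemma circle_fracK t : circle_pi (circle_frac t) = t.
Proof.
have [x xt] := circle_pi_surj t; rewrite /circle_frac.
have := @xgetPex _ 0 (circle_pi @^-1` [set t]) (ex_intro _ x xt).
move: (xget _ _) => /= y yt; rewrite -[RHS]yt; apply/circle_piP.
by rewrite addrAC subrr add0r rpredN intr_int.
Qed.

Lemma circle_frac_itv t : 0 <= circle_frac t < 1.
Proof.
by rewrite /circle_frac subr_ge0 ltrBlDl floor_le -intrD1 floorD1_gt.
Qed.

Lemma circle_piK x : 0 <= x < 1 -> circle_frac (circle_pi x) = x.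
Proof.
move=> /andP[x0 x1]; have /andP[y0 y1] := circle_frac_itv (circle_pi x).
have /circle_piP/intrP[n xyn] := circle_fracK (circle_pi x).
have nN1 : (-1)%:~R < (n%:~R : R) by rewrite -xyn rmorphN1; lra.
have n1 : n%:~R < (1%:~R : R) by rewrite -xyn; lra.
move: nN1 n1; rewrite !ltr_int => nN1 n1.
have n_0 : n = 0 by lia.
by apply/eqP; rewrite -subr_eq0 xyn n_0.
Qed.

Lemma measurable_circle_frac : measurable_fun [set: circle] circle_frac.
Proof.
apply: (measurability _ (RGenOInfty.measurableE R)) => _ [_ [a ->] <-].
rewrite setTI; have [a0|a0] := ltP a 0.
  rewrite (_ : _ @^-1` _ = setT); first exact: measurableT.
  apply/seteqP; split=> // t _ /=; rewrite in_itv /= andbT.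
  by have /andP[t0 _] := circle_frac_itv t; exact: lt_le_trans t0.
apply: sub_sigma_algebra.
rewrite (_ : _ @^-1` _ = circle_pi @` `]a, 1[).
  by apply: circle_pi_open; exact: interval_open.
apply/seteqP; split=> [t /=|_ [x /= ax <-]].
  rewrite in_itv /= andbT => at_; exists (circle_frac t); last exact: circle_fracK.
  by rewrite /= in_itv /= at_; case/andP: (circle_frac_itv t).
rewrite in_itv /= andbT; move: ax; rewrite in_itv /= => /andP[ax x1].
by rewrite circle_piK// x1 (le_trans a0 (ltW ax)).
Qed.

Definition circle_add (p : circle * circle) : circle := p.1 + p.2.

Lemma measurable_circle_add : measurable_fun [set: circle * circle] circle_add.
Proof.
rewrite (_ : circle_add =
  circle_pi \o (fun p => circle_frac p.1 + circle_frac p.2)); last first.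
  by apply/funext => p /=; rewrite circle_piD !circle_fracK.
apply: measurableT_comp; first exact: measurable_circle_pi.
apply: measurable_funD.
  apply: measurableT_comp; [exact: measurable_circle_frac|exact: measurable_fst].
apply: measurableT_comp; [exact: measurable_circle_frac|exact: measurable_snd].
Qed.

HB.instance Definition _ := isMeasurableFun.Build _ _ _ _ circle_frac
  measurable_circle_frac.
HB.instance Definition _ := isMeasurableFun.Build _ _ _ _ circle_pi
  measurable_circle_pi.
HB.instance Definition _ := isMeasurableFun.Build _ _ _ _ circle_add
  measurable_circle_add.

Lemma circle_cozero (U : set circle) : open U ->
  exists2 h : circle -> R, continuous h & U = h @^-1` `]0, +oo[.
Proof.
move=> oU; pose C := ~` (circle_pi @^-1` U).
have [C0|/set0P[c0 Cc0]] := eqVneq C set0.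
  exists (fun=> 1); first exact: cst_continuous.
  apply/seteqP; split=> t _ /=; first by rewrite in_itv /= andbT.
  have [x <-] := circle_pi_surj t; apply: contrapT => nUx.
  by have : C x by []; rewrite C0.
pose D x : set R := [set `|x - c| | c in C].
pose g x := inf (D x).
have D0 x : lbound (D x) 0 by move=> _ [c _ <-]; exact: normr_ge0.
have Dn0 x : D x !=set0 by exists `|x - c0|; exists c0.
have g_le x c : C c -> g x <= `|x - c|.
  by move=> Cc; apply: ge_inf; [exists 0; exact: D0|exists c].
have g_lip x y : g x - `|x - y| <= g y.
  apply: lb_le_inf => // _ [c Cc <-]; rewrite lerBlDl.
  by apply: le_trans (g_le _ _ Cc) _; rewrite (le_trans _ (ler_normD _ _))// addrA subrK.
have g_cont : continuous g.
  move=> x; apply/cvgrPdist_le => e e0; near=> y.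
  have xy : `|x - y| <= e.
    by near: y; apply: cvgr_dist_le => //; exact: cvg_id.
  rewrite ler_norml; apply/andP; split.
    by have := g_lip y x; rewrite distrC; lra.
  by have := g_lip x y; lra.
have CD x (n : int) : C x -> C (x + n%:~R).
  rewrite /C /= (_ : circle_pi (x + _) = circle_pi x)//.
  by apply/circle_piP; rewrite addrAC subrr add0r intr_int.
have g_le_per x (n : int) : g x <= g (x + n%:~R).
  apply: lb_le_inf => // _ [c Cc <-].
  have := g_le x _ (CD c (- n) Cc); rewrite rmorphN /=.
  by congr (_ <= `| _ |); ring.
have gE x y : circle_pi x = circle_pi y -> g x = g y.
  move=> /circle_piP/intrP[n xyn]; apply/eqP; rewrite eq_le; apply/andP; split.
    by have := g_le_per x (- n); rewrite rmorphN /= -xyn opprB addrC subrK.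
  by have := g_le_per y n; rewrite -xyn addrC subrK.
have hE x : g (circle_frac (circle_pi x)) = g x by apply: gE; exact: circle_fracK.
exists (g \o circle_frac).
  apply/continuousP => W oW; rewrite circle_openE.
  rewrite (_ : _ @^-1` _ = g @^-1` W); first by move/continuousP: g_cont; exact.
  by apply/funext => x; rewrite /preimage /= hE.
apply/seteqP; split=> t; have [x <-] := circle_pi_surj t.
  move=> Ux /=; rewrite in_itv /= andbT hE.
  have /nbhs_ballP[e /= e0 eU] : nbhs x (circle_pi @^-1` U).
    by apply: open_nbhs_nbhs; split.
  apply: (lt_le_trans e0); apply: lb_le_inf => // _ [c Cc <-].
  by rewrite leNgt; apply/negP => xc; apply: Cc; exact: eU.
rewrite /= in_itv /= andbT hE => gx0; apply: contrapT => Cx.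
by have := g_le x _ Cx; rewrite subrr normr0 leNgt gx0.
Unshelve. all: by end_near. Qed.

End circle_measurability.

Section iota_map.
Variables (R : realType) (K : topologicalZmodType).

Definition iota_map (k : baire R K) : mpow (pdual R K) (circle R) :=
  fun khat => khat k.

Lemma measurable_character (khat : pdual R K) :
  measurable_fun [set: baire R K] (khat : baire R K -> circle R).
Proof.
apply: (measurability (@open (circle R)) erefl) => _ [_ /circle_cozero[h ch ->] <-].
apply: sub_sigma_algebra; exists (h \o khat).
  by move=> k; apply: continuous_comp; [exact: pdual_continuous|exact: ch].
by exists `]0, +oo[%classic; [exact: measurable_itv|].
Qed.

Lemma measurable_iota_map : measurable_fun [set: baire R K] iota_map.
Proof.
apply: (@measurability _ _ (baire R K) (mpow (pdual R K) (circle R)) setT iota_map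
  (@cylinders _ (pdual R K) (circle R)) erefl).
move=> _ [_ [khat _ [B mB <-]] <-].
have := measurable_character khat measurableT mB; congr measurable.
by rewrite !setTI.
Qed.

HB.instance Definition _ := isMeasurableFun.Build _ _ _ _ iota_map measurable_iota_map.
End iota_map.

Section identifications.
Context {R : realType} {d : measure_display} {X : measurableType d}.
Variable mu : {measure set X -> \bar R}.

Definition cond_coords (d' : measure_display) (I : Type) (T : measurableType d')
    (f : cond mu (mpow I T)) : I -> cond mu T :=
  fun i => cond_map (mpow_proj i) f.

End identifications.

HB.instance Definition _ d1 d2 (Y : measurableType d1) (Z : measurableType d2) :=
  isMeasurableFun.Build _ _ _ _ (@fst Y Z) measurable_fst.
HB.instance Definition _ d1 d2 (Y : measurableType d1) (Z : measurableType d2) :=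
  isMeasurableFun.Build _ _ _ _ (@snd Y Z) measurable_snd.

Section cond_pair.
Context {R : realType} {d : measure_display} {X : measurableType d}.
Variable mu : {measure set X -> \bar R}.

Definition cond_coords2 d1 d2 (Y : measurableType d1) (Z : measurableType d2)
    (p : cond mu (Y * Z)%type) : cond mu Y * cond mu Z :=
  (cond_map (@fst Y Z) p, cond_map (@snd Y Z) p).

Lemma cond_ext d' (Y : measurableType d') (G : set (set Y)) (y z : cond mu Y) :
  @measurable _ Y = <<s G >> -> (forall E : msets Y, G E -> y E = z E) -> y = z.
Proof.
move=> YG yz; apply/cond_eq/funext => E.
pose S : set (set Y) := [set A | exists mA : measurable A,
  y (MSet mA) = z (MSet mA)].
suff [mE yzE] : S E by rewrite (_ : E = MSet mE)//; exact: mset_inj.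
have : <<s G >> E by rewrite -YG; exact: mset_measurable.
apply: smallest_sub; last first.
  move=> A GA; have mA : measurable A by rewrite YG; exact: sub_sigma_algebra.
  by exists mA; exact: yz.
split.
- by exists measurable0; rewrite -[MSet _]/mset0 (pullback0 y) (pullback0 z).
- move=> A [mA yzA]; rewrite setTD; exists (measurableC mA).
  rewrite -[MSet _]/(msetC (MSet mA)).
  by rewrite (pullbackC y) (pullbackC z) yzA.
- move=> A SA; have mA n : measurable (A n) by have [] := SA n.
  have yzA n : y (MSet (mA n)) = z (MSet (mA n)).
    by have [m] := SA n; rewrite (Prop_irrelevance m (mA n)).
  pose B n := MSet (mA n); exists (mset_measurable (mset_bigcup B)).
  rewrite -[MSet _]/(mset_bigcup B).
  have yS := pullback_bigcup y B; have zS := pullback_bigcup z B.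
  apply: is_subset1_supremums yS _.
  rewrite (_ : (fun n => y (B n)) = (fun n => z (B n)))//.
  exact/funext.
Qed.

Lemma cond_map_comp d1 d2 d3 (Y1 : measurableType d1) (Y2 : measurableType d2)
    (Y3 : measurableType d3) (f : {mfun Y1 >-> Y2}) (g : {mfun Y2 >-> Y3})
    (h : {mfun Y1 >-> Y3}) (y : cond mu Y1) :
  (forall x, h x = g (f x)) -> cond_map g (cond_map f y) = cond_map h y.
Proof.
move=> hgf; apply/cond_eq/funext => E /=; congr (y _); apply: mset_inj.
by apply/seteqP; split=> x /=; rewrite hgf.
Qed.

Lemma cond_map_of d1 d2 (Y1 : measurableType d1) (Y2 : measurableType d2)
    (f : {mfun X >-> Y1}) (g : {mfun Y1 >-> Y2}) (h : {mfun X >-> Y2}) :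
  (forall x, h x = g (f x)) -> cond_map g (cond_of mu f) = cond_of mu h.
Proof.
move=> hgf; apply/cond_eq/funext => E /=; congr mcls; apply: mset_inj.
by apply/seteqP; split=> x /=; rewrite hgf.
Qed.

Lemma cond_mapK d1 d2 (Y1 : measurableType d1) (Y2 : measurableType d2)
    (f : {mfun Y1 >-> Y2}) (g : {mfun Y2 >-> Y1}) (y : cond mu Y1) :
  (forall x, g (f x) = x) -> cond_map g (cond_map f y) = y.
Proof.
move=> gfid; apply/cond_eq/funext => E /=; congr (y _); apply: mset_inj.
by apply/seteqP; split=> x /=; rewrite gfid.
Qed.

(* Elements of Cond(R / Z) are represented by measurable maps X -> R / Z. This
   makes the identifications below bijective. *)
Lemma cond_circle_of (t : cond mu (circle R)) :
  exists f : {mfun X >-> circle R}, t = cond_of mu f.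
Proof.
pose z := cond_map (@circle_frac R) t.
pose ray (r : R) : msets R := MSet (measurable_itv `]-oo, r[).
pose A (r : R) : msets X := repr (z (ray r)).
have zA r : z (ray r) = mcls mu (A r) by rewrite /mcls reprK.
pose sel (T : Type) (T0 : T) (F : R -> T) (r : R) (n : nat) : T :=
  if @unpickle rat n is Some q then
    if (0 <= (ratr q : R)) && (ratr q < r) then F (ratr q) else T0 else T0.
pose Q (r : R) : msets R := mset_bigcup (sel (msets R) mset0 ray r).
pose B (r : R) : msets X := mset_bigcup (sel (msets X) mset0 A r).
have zQ r : z (Q r) = mcls mu (B r).
  have zS := pullback_bigcup z (sel _ mset0 ray r).
  have AS := mcls_bigcup mu (sel _ mset0 A r).
  have zE : (fun n => z (sel _ mset0 ray r n)) =
      (fun n => mcls mu (sel _ mset0 A r n)).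
    apply/funext => n; rewrite /sel; case: unpickle => [q|].
      by case: ifPn => _; rewrite ?zA// (pullback0 z).
    by rewrite (pullback0 z).
  by rewrite zE in zS; exact: is_subset1_supremums zS AS.
have BE r x : (B r : set X) x <->
    exists q : rat, ((0 <= (ratr q : R)) && (ratr q < r)) /\ (A (ratr q) : set X) x.
  split=> [[n _]|[q [qr Aqx]]]; rewrite /sel.
    case: unpickle => [q|//]; case: ifPn => // qr Aqx.
    by exists q.
  by apply: (ex_intro2 _ _ (pickle q) I); rewrite /sel pickleK qr.
have rayQ r : z (ray r) = z (Q r).
  congr (t _); apply: mset_inj; apply/seteqP; split=> s /=.
    rewrite in_itv /= => sr; have /andP[s0 _] := circle_frac_itv s.
    have [q] := rat_in_itvoo sr; rewrite in_itv /= => /andP[sq qr].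
    apply: (ex_intro2 _ _ (pickle q) I).
    rewrite /sel pickleK qr (le_trans s0 (ltW sq)) /=.
    by rewrite in_itv.
  move=> [n _]; rewrite /sel; case: unpickle => [q|//]; case: ifPn => //.
  by move=> /andP[_ qr] /=; rewrite !in_itv /= => /lt_trans; apply.
pose S x : set R := [set r | r = 1 \/
  exists q : rat, [/\ 0 <= (ratr q : R), r = ratr q & (A r : set X) x]].
pose f x := inf (S x).
have S0 x : lbound (S x) 0 by move=> _ [->|[q [q0 -> _]]].
have S1 x : S x 1 by left.
have fr (r : R) : r <= 1 -> f @^-1` `]-oo, r[ = B r.
  move=> r1; apply/seteqP; split=> x /=; rewrite in_itv /=.
    move=> /(inf_lt (ex_intro _ _ (S1 x)))[s [->|[q [q0 -> Aq]]] sr].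
      by move: sr; rewrite ltNge r1.
    by apply/BE; exists q; rewrite q0.
  move=> /BE[q [/andP[q0 qr] Aqx]]; apply: le_lt_trans qr.
  by apply: ge_inf; [exists 0|right; exists q].
have fr1 (r : R) : 1 < r -> f @^-1` `]-oo, r[ = setT.
  move=> r1; apply/seteqP; split=> x //= _; rewrite in_itv /=.
  by apply: le_lt_trans r1; apply: ge_inf; [exists 0|].
have mf : measurable_fun [set: X] f.
  apply: (measurability _ (RGenInftyO.measurableE R)) => _ [_ [r ->] <-].
  rewrite setTI; have [r1|r1] := leP r 1; last by rewrite fr1.
  by rewrite fr//; exact: mset_measurable.
pose mfX := isMeasurableFun.Build _ _ _ _ f mf.
pose F : {mfun X >-> R} := HB.pack f mfX.
pose mpfX := isMeasurableFun.Build _ _ _ _ (@circle_pi R \o f)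
  (measurableT_comp (@measurable_circle_pi R) mf).
pose pF : {mfun X >-> circle R} := HB.pack (@circle_pi R \o f) mpfX.
exists pF; rewrite -(@cond_map_of _ _ _ _ F (@circle_pi R) pF)//.
suff <- : z = cond_of mu F by rewrite cond_mapK// => s; exact: circle_fracK.
apply: (@cond_ext _ _ (@RGenInftyO.G R) z (cond_of mu F)
  (RGenInftyO.measurableE R)) => E [r Er].
have {Er E} -> : E = ray r by exact: mset_inj.
have [r1|r1] := leP r 1.
  rewrite rayQ zQ; congr mcls; apply: mset_inj => /=; exact/esym/fr.
transitivity (t msetT).
  congr (t _); apply: mset_inj; apply/seteqP; split=> s //= _.
  by rewrite in_itv /=; apply: lt_trans r1; case/andP: (circle_frac_itv s).
by rewrite (pullbackT t); congr mcls; apply: mset_inj => /=; rewrite fr1.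
Qed.

Lemma cond_coords_inj d' (I : Type) (T : measurableType d') :
  injective (@cond_coords _ _ _ mu d' I T).
Proof.
move=> y z yz; apply: (@cond_ext _ (mpow I T) (@cylinders _ I T) y z erefl) => E. 
move=> [i _ [F mF FE]]; have /(congr1 (fun w : cond mu T => w (MSet mF))) :=
  congr1 (@^~ i) yz.
have -> // : E = mset_preimage (@mpow_proj d' I T i) (MSet mF).
by apply: mset_inj; rewrite -FE /= setTI.
Qed.

Lemma cond_coords_bij (I : Type) : bijective (@cond_coords _ _ _ mu _ I (circle R)).
Proof.
rewrite -setTT_bijective; split=> //; first by move=> y z _ _; exact: cond_coords_inj.
move=> theta _; have /choice[f fE] i := cond_circle_of (theta i).
pose g (x : X) : mpow I (circle R) := fun i => f i x.
have mg : measurable_fun [set: X] g.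
  apply: (@measurability _ _ X (mpow I (circle R)) setT g
    (@cylinders _ I (circle R)) erefl).
  move=> _ [_ [i _ [B mB <-]] <-].
  have := @measurable_funPT _ _ _ _ (f i) measurableT _ mB.
  by rewrite !setTI.
pose mgX := isMeasurableFun.Build _ _ _ _ g mg.
pose G : {mfun X >-> mpow I (circle R)} := HB.pack g mgX.
exists (cond_of mu G) => //; apply/funext => i; rewrite fE.
exact: cond_map_of.
Qed.

Lemma cond_coords2_inj d1 d2 (Y : measurableType d1) (Z : measurableType d2) :
  injective (@cond_coords2 _ _ Y Z).
Proof.
move=> y z [yz1 yz2]; apply: (@cond_ext _ (Y * Z)%type
  (preimage_set_system [set: Y * Z] fst measurable `|`
   preimage_set_system [set: Y * Z] snd measurable) y z erefl) => E.
move=> [] [F mF FE].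
- have := congr1 (fun w : msets Y -> malg mu => w (MSet mF)) yz1.
  have -> // : E = mset_preimage (@fst Y Z) (MSet mF).
  by apply: mset_inj; rewrite -FE /= setTI.
- have := congr1 (fun w : msets Z -> malg mu => w (MSet mF)) yz2.
  have -> // : E = mset_preimage (@snd Y Z) (MSet mF).
  by apply: mset_inj; rewrite -FE /= setTI.
Qed.

Lemma cond_coords2_surj (t t' : cond mu (circle R)) :
  exists p, cond_coords2 p = (t, t').
Proof.
have [f ->] := cond_circle_of t; have [g ->] := cond_circle_of t'.
pose h (x : X) : circle R * circle R := (f x, g x).
have mh : measurable_fun [set: X] h by exact: measurable_fun_pair.
pose mhX := isMeasurableFun.Build _ _ _ _ h mh.
pose H : {mfun X >-> (circle R * circle R)%type} := HB.pack h mhX.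
by exists (cond_of mu H); congr pair; exact: cond_map_of.
Qed.

(* The element of Cond(T^2) identified with (t, t'); it is unique by
   cond_coords2_inj. *)
Definition cond_pair (t t' : cond mu (circle R)) :
    cond mu (circle R * circle R)%type :=
  projT1 (cid (cond_coords2_surj t t')).

Lemma cond_pairE t t' : cond_coords2 (cond_pair t t') = (t, t').
Proof. exact: projT2 (cid (cond_coords2_surj t t')). Qed.

Definition cond_add (t t' : cond mu (circle R)) : cond mu (circle R) :=
  cond_map (@circle_add R) (cond_pair t t').
End cond_pair.

(* Main.v *)
(* A compact abelian group carries an invariant mean on its bounded functions.
   For u continuous with u 0 != u x0, put v x = u x - u (x + x0). The symmetric
   operator with kernel v (z + x) has an eigenfunction for its square, obtained by
   power iteration; by Bessel's inequality the eigenspace has finite dimension,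
   translations act on it by commuting matrices, and a common eigenvector gives a
   continuous character which is nontrivial at x0. Hence characters separate points
   and, by compactness, every Baire set is the preimage under iota of a measurable
   set, which gives injectivity.

   Conversely, represent an additive theta by measurable maps f_k : X -> T. A
   measurable set of T^(dual K) depends on countably many coordinates; for almost
   every x the values f_k x on these satisfy all integer relations among the
   characters, so that by Kronecker's theorem (proved by comparing means of powers
   of a trigonometric product) they are the coordinates of some iota k. So the
   class of the set pulled back to X depends only on its preimage under iota,
   which defines a conditional element of K. *)
Require Import Defs.
From HB Require Import structures.
From mathcomp Require Import all_boot all_order all_algebra.
From mathcomp Require Import ring lra complex.
From mathcomp Require Import all_classical all_reals all_analysis.
From mathcomp Require Import measurable_realfun.

Set Implicit Arguments.
Unset Strict Implicit.
Unset Printing Implicit Defensive.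
Import Order.TTheory GRing.Theory Num.Theory.
Import numFieldNormedType.Exports.
Local Open Scope classical_set_scope.
Local Open Scope ring_scope.

(** * Invariant means *)

(** The mean is only finitely additive, so integration on [K] stays within what compactness gives:
    strict positivity and Fubini for continuous functions, and uniform limits. Uniformity comes from
    smoothing: by Cauchy-Schwarz the operator bounds the sup norm of its image by the mean-square
    norm of its argument, so power iteration converges among continuous functions. The kernel
    [v (z + x)] is symmetric for every [v] but reverses translations; its square commutes with them,
    whence eigenfunctions of the square. The choice of [v] ensures that a function invariant under
    [x0] is annihilated by the operator, so that no nonzero eigenfunction for a positive eigenvalue
    is invariant under [x0]. In the converse, each relation [theta (k + k') = theta k + theta k']
    holds off a null set that depends on the pair, and the dual may be uncountable: for no [x] need
    the values [f_k x] be additive in all of [k]. Only countably many relations can be imposed at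
    once. *)

Section invariant_mean.
Context {R : realType} {K : zmodType}.
Implicit Types (f g : K -> R) (a x : K) (p : K * nat) (l : seq (K * nat)).

Definition bounded_map f := exists C : R, forall x, `|f x| <= C.

(** The laws concern bounded functions because the mean is built as a limit along an ultrafilter,
    whose existence rests on boundedness. Discontinuous functions are included: Fubini below takes
    means of indicators. *)
Record invariant_mean := InvariantMean {
  mean :> (K -> R) -> R ;
  meanD : forall f g, bounded_map f -> bounded_map g ->
    mean (fun x => f x + g x) = mean f + mean g ;
  meanZ : forall c f, bounded_map f -> mean (fun x => c * f x) = c * mean f ;
  mean_ge0 : forall f, bounded_map f -> (forall x, 0 <= f x) -> 0 <= mean f ;
  mean1 : mean (fun=> 1) = 1 ;
  mean_shift : forall a f, bounded_map f -> mean (fun x => f (x + a)) = mean f }.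

Lemma bounded_mapD f g :
  bounded_map f -> bounded_map g -> bounded_map (fun x => f x + g x).
Proof.
by move=> [C fC] [D gD]; exists (C + D) => x; rewrite (le_trans (ler_normD _ _))// lerD.
Qed.

Lemma bounded_mapM f g :
  bounded_map f -> bounded_map g -> bounded_map (fun x => f x * g x).
Proof. by move=> [C fC] [D gD]; exists (C * D) => x; rewrite normrM ler_pM. Qed.

Lemma bounded_map_cst c : bounded_map (fun=> c).
Proof. by exists `|c|. Qed.

Lemma bounded_mapZ c f : bounded_map f -> bounded_map (fun x => c * f x).
Proof. by apply: bounded_mapM; exact: bounded_map_cst. Qed.

Lemma bounded_mapB f g :
  bounded_map f -> bounded_map g -> bounded_map (fun x => f x - g x).
Proof.
move=> bf [D gD]; apply: bounded_mapD => //.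
by exists D => x; rewrite normrN.
Qed.

Lemma bounded_map_shift a f : bounded_map f -> bounded_map (fun x => f (x + a)).
Proof. by move=> [C fC]; exists C. Qed.

Lemma bounded_map_sum (I : Type) (s : seq I) (P : pred I) (F : I -> K -> R) :
  (forall i, P i -> bounded_map (F i)) ->
  bounded_map (fun x => \sum_(i <- s | P i) F i x).
Proof.
move=> bF; rewrite (_ : (fun _ => _) = \big[(fun f g x => f x + g x)/(fun=> 0)]_(i <- s | P i) F i).
  by elim/big_ind : _ => //; [exact: bounded_map_cst|exact: bounded_mapD].
apply/funext => x; elim: s => [|i s IH]; first by rewrite !big_nil.
by rewrite !big_cons; case: ifPn => // _; rewrite IH.
Qed.

Definition progression_average p f x : R :=
  p.2.+1%:R^-1 * \sum_(i < p.2.+1) f (x + p.1 *+ i).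

Definition iterated_average l f : K -> R := foldr progression_average f l.

Lemma iterated_averageD l f g :
  iterated_average l (fun x => f x + g x) =
  (fun x => iterated_average l f x + iterated_average l g x).
Proof.
elim: l => //= p l ->; apply/funext => x.
by rewrite /progression_average big_split mulrDr.
Qed.

Lemma iterated_averageZ l c f :
  iterated_average l (fun x => c * f x) = (fun x => c * iterated_average l f x).
Proof.
elim: l => //= p l ->; apply/funext => x.
by rewrite /progression_average -mulr_sumr mulrCA.
Qed.

Lemma iterated_average_ge0 l f :
  (forall x, 0 <= f x) -> forall x, 0 <= iterated_average l f x.
Proof.
move=> f0; elim: l => //= p l IH x.
by rewrite mulr_ge0 ?invr_ge0 ?ler0n// sumr_ge0.
Qed.

Lemma iterated_average_cst l c : iterated_average l (fun=> c) = fun=> c.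
Proof.
elim: l => //= p l ->; apply/funext => x.
by rewrite /progression_average sumr_const card_ord -[c *+ _]mulr_natl mulrA mulVf ?mul1r// pnatr_eq0.
Qed.

Lemma iterated_average_shift l a f :
  iterated_average l (fun x => f (x + a)) = (fun x => iterated_average l f (x + a)).
Proof.
elim: l => //= p l ->; apply/funext => x; rewrite /progression_average.
by congr (_ * _); apply: eq_bigr => i _; rewrite addrAC.
Qed.

Lemma progression_average_norm p C f :
  (forall x, `|f x| <= C) -> forall x, `|progression_average p f x| <= C.
Proof.
move=> fC x; rewrite /progression_average normrM ger0_norm ?invr_ge0 ?ler0n//.
rewrite ler_pdivrMl ?ltr0n// (le_trans (ler_norm_sum _ _ _))//.
rewrite (le_trans (ler_sum _ (fun i _ => fC _)))//.
by rewrite sumr_const card_ord mulr_natl.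
Qed.

Lemma iterated_average_norm l C f :
  (forall x, `|f x| <= C) -> forall x, `|iterated_average l f x| <= C.
Proof. by move=> fC; elim: l => //= p l; exact: progression_average_norm. Qed.

(** The sum telescopes: only the two end values survive, while the divisor is [n.+1]. *)
Lemma progression_average_shiftB a n C f : (forall x, `|f x| <= C) ->
  forall x, `|progression_average (a, n) (fun x => f (x + a) - f x) x|
            <= n.+1%:R^-1 * (C + C).
Proof.
move=> fC x; rewrite /progression_average normrM ger0_norm ?invr_ge0 ?ler0n//=.
rewrite ler_wpM2l ?invr_ge0 ?ler0n//.
rewrite -(big_mkord predT (fun i => f (x + a *+ i + a) - f (x + a *+ i))).
under eq_bigr do rewrite -addrA -mulrSr.
rewrite telescope_sumr// (le_trans (ler_normB _ _))// lerD//.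
Qed.

(** Averages commute with translations, so the difference can be carried past those applied before
    [(a, n)]; those applied after it do not increase the sup bound. *)
Lemma iterated_average_shiftB l a n C f : (a, n) \in l ->
  (forall x, `|f x| <= C) ->
  forall x, `|iterated_average l (fun x => f (x + a) - f x) x| <= n.+1%:R^-1 * (C + C).
Proof.
move=> + fC; elim: l => //= p l IH; rewrite inE => /predU1P[<-|/IH]; last first.
  exact: progression_average_norm.
rewrite (_ : iterated_average l _ =
    (fun x => iterated_average l f (x + a) - iterated_average l f x)).
  exact/progression_average_shiftB/iterated_average_norm.
under [X in iterated_average l X]eq_fun do rewrite -mulN1r.
rewrite iterated_averageD iterated_averageZ iterated_average_shift.
by apply/funext => x; rewrite mulN1r.
Qed.

(* The mean is a limit of iterated averages along an ultrafilter that eventually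
   contains every progression. *)
Lemma invariant_mean_exists : inhabited invariant_mean.
Proof.
pose F := filter_from [set: seq (K * nat)] (fun l => [set l' : seq (K * nat) | {subset l <= l'}]).
have FF : ProperFilter F.
  apply: filter_from_proper; last by move=> l _; exists l.
  apply: filter_from_filter; first by exists [::].
  move=> l l' _ _; exists (l ++ l') => // l'' ll''.
  by split=> p pl; apply: ll''; rewrite mem_cat pl ?orbT.
have [U [UU FU]] := ultraFilterLemma FF.
have PU : ProperFilter U by exact: ultra_proper.
pose M f : R := lim (iterated_average l f 0 @[l --> U]).
have cvM f : bounded_map f -> iterated_average l f 0 @[l --> U] --> M f.
  move=> [C fC].
  (* An ultrafilter on a compact segment converges to any of its cluster points. *)
  have [] := @segment_compact R (- C) C (iterated_average l f 0 @[l --> U]) _ _.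
    change (U ((fun l => iterated_average l f 0) @^-1` `[- C, C]%classic)).
    apply: filterE => l /=; rewrite in_itv /= -ler_norml.
    exact: iterated_average_norm.
  move=> y [_ fy]; suff cy : iterated_average l f 0 @[l --> U] --> y.
    by rewrite /M (cvg_lim _ cy).
  move=> V nV.
  have [//|UV] := in_ultra_setVsetC ((fun l => iterated_average l f 0) @^-1` V) UU.
  by have [z []] := fy (~` V) V UV nV.
exists; exists M.
- move=> f g bf bg; apply: cvg_lim => //.
  by under eq_cvg do rewrite iterated_averageD; apply: cvgD; exact: cvM.
- move=> c f bf; apply: cvg_lim => //.
  under eq_cvg do rewrite iterated_averageZ.
  by apply: cvgM; [exact: cvg_cst|exact: cvM].
- move=> f bf f0; apply: (cvgr_to_ge (cvM f bf)).
  by apply: nearW => l; exact: iterated_average_ge0.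
- apply: cvg_lim => //.
  under eq_cvg do rewrite iterated_average_cst.
  exact: cvg_cst.
- move=> a f bf; have [C fC] := bf.
  have bfa := bounded_map_shift a bf.
  apply/eqP; rewrite -subr_eq0; apply/eqP.
  have cv : iterated_average l (fun x => f (x + a) - f x) 0 @[l --> U]
      --> M (fun x => f (x + a)) - M f.
    rewrite (_ : (fun _ => _) = (fun l => iterated_average l (fun x => f (x + a)) 0
      - iterated_average l f 0)).
      by apply: cvgB; exact: cvM.
    apply/funext => l; under [X in iterated_average l X]eq_fun do rewrite -mulN1r.
    by rewrite iterated_averageD iterated_averageZ mulN1r.
  apply/eqP; rewrite -normr_eq0 eq_le normr_ge0 andbT.
  apply/ler_addgt0Pr => e e0; rewrite add0r.
  have C0 : 0 <= C by exact: le_trans (normr_ge0 _) (fC 0).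
  (* Chosen so that [2 C / n.+1 <= e]. *)
  pose n := Num.truncn ((C + C) / e).
  have nC : n.+1%:R^-1 * (C + C) <= e.
    rewrite ler_pdivrMl ?ltr0n// -ler_pdivrMr//.
    by apply: ltW; exact: truncnS_gt.
  apply: (cvgr_to_le (cvg_norm cv)).
  have : F [set l : seq (K * nat) | (a, n) \in l].
    by exists [:: (a, n)] => // l /(_ (a, n)); apply; rewrite inE eqxx.
  move=> /FU; apply: filterS => l /= al.
  exact: le_trans (iterated_average_shiftB al fC 0) nC.
Qed.

End invariant_mean.

(** * Uniformity from compactness *)

Lemma compact_finite_cover (T : topologicalType) (U : T -> set T) :
  compact [set: T] -> (forall x, nbhs x (U x)) ->
  exists s : seq T, forall y, exists2 x, x \in s & U x y.
Proof.
move=> /compact_near_coveringP cT nU.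
(* Filter of the finite lists ordered by inclusion: near covering along it makes one list work for
   all points. *)
pose F := filter_from [set: seq T] (fun s => [set s' : seq T | {subset s <= s'}]).
have FF : ProperFilter F.
  apply: filter_from_proper; last by move=> l _; exists l.
  apply: filter_from_filter; first by exists [::].
  move=> l l' _ _; exists (l ++ l') => // l'' ll''.
  by split=> p pl; apply: ll''; rewrite mem_cat pl ?orbT.
have [|s _ sU] := cT _ F (fun (s : seq T) y => exists2 x, x \in s & U x y) _.
  move=> x _; exists (U x, [set s : seq T | x \in s]); first split => //=.
    by exists [:: x] => // s /(_ x); apply; rewrite inE.
  by move=> [y s] [/= Uxy xs]; exists x.
by exists s => y; exact: sU.
Qed.

(** A tube lemma: continuity at each [(x, y)] gives a product neighbourhood, and compactness of the
    first factor leaves a single neighbourhood of [y]. *)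
Lemma compact_uniformly_near (T S : topologicalType) (R : realType)
    (F : T * S -> R) (y : S) (e : R) :
  compact [set: T] -> continuous F -> 0 < e ->
  \forall z \near y, forall x, `|F (x, z) - F (x, y)| < e.
Proof.
move=> /compact_near_coveringP cT cF e0.
suff : \forall z \near y, [set: T] `<=` (fun x => `|F (x, z) - F (x, y)| < e).
  by apply: filterS => z zF x; exact: zF.
apply: cT => x _; have e2 : 0 < e / 2 by rewrite divr_gt0.
have /cvgrPdist_lt/(_ _ e2)[[A B] /= [nA nB] AB] := cF (x, y).
exists (A, B) => // -[x' z] [/= Ax' Bz].
have := AB (x', z) (conj Ax' Bz); have := AB (x', y) (conj Ax' (nbhs_singleton nB)).
by rewrite /= !ltr_norml => /andP[? ?] /andP[? ?]; apply/andP; split; lra.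
Qed.

Lemma compact_bounded_map (R : realType) (K : topologicalZmodType) (f : K -> R) :
  compact [set: K] -> continuous f -> bounded_map f.
Proof.
move=> cK cf.
have nU x : nbhs x [set y | `|f x - f y| < 1].
  by have /cvgrPdist_lt/(_ _ ltr01) := cf x.
have [s sP] := compact_finite_cover cK nU.
(* A sum of nonnegative terms bounds each of them, in place of a maximum. *)
exists (\sum_(x <- s) (`|f x| + 1)) => y; have [x xs /ltW xy] := sP y.
rewrite (big_rem x)//=; apply: (@le_trans _ _ (`|f x| + 1)).
  by rewrite -{1}[f y](subrKC (f x)) (le_trans (ler_normD _ _))// lerD2l distrC.
by rewrite lerDl sumr_ge0// => z _; rewrite addr_ge0.
Qed.

Section mean_theory.
Context {R : realType} {K : zmodType} (M : @invariant_mean R K).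
Implicit Types (f g : K -> R).

Lemma meanB f g : bounded_map f -> bounded_map g ->
  M (fun x => f x - g x) = M f - M g.
Proof.
move=> bf bg; under [X in M X]eq_fun do rewrite -mulN1r.
by rewrite meanD ?meanZ ?mulN1r//; exact: bounded_mapZ.
Qed.

Lemma mean_cst c : M (fun=> c) = c.
Proof.
by rewrite -{1}(mulr1 c) meanZ ?mean1 ?mulr1//; exact: bounded_map_cst.
Qed.

Lemma mean_sum (I : Type) (s : seq I) (P : pred I) (F : I -> K -> R) :
  (forall i, P i -> bounded_map (F i)) ->
  M (fun x => \sum_(i <- s | P i) F i x) = \sum_(i <- s | P i) M (F i).
Proof.
move=> bF; elim: s => [|i s IH].
  rewrite big_nil; under [X in M X]eq_fun do rewrite big_nil.
  exact: mean_cst.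
rewrite big_cons; under [X in M X]eq_fun do rewrite big_cons.
case: ifPn => // Pi; rewrite meanD ?IH//; first exact: bF.
exact: bounded_map_sum.
Qed.

Lemma le_mean f g : bounded_map f -> bounded_map g -> (forall x, f x <= g x) ->
  M f <= M g.
Proof.
move=> bf bg fg; rewrite -subr_ge0 -meanB//.
by apply: mean_ge0 => [|x]; [exact: bounded_mapB|rewrite subr_ge0].
Qed.

Lemma mean_le_norm f C : (forall x, `|f x| <= C) -> `|M f| <= C.
Proof.
move=> fC; have bf : bounded_map f by exists C.
have bC c := @bounded_map_cst R K c.
have fCC x : - C <= f x <= C by rewrite -ler_norml.
rewrite ler_norml -{1}(mean_cst (- C)) -{2}(mean_cst C).
by apply/andP; split; apply: le_mean => // x; have /andP[] := fCC x.
Qed.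

Lemma mean_dist f g C : bounded_map f -> bounded_map g ->
  (forall x, `|f x - g x| <= C) -> `|M f - M g| <= C.
Proof. by move=> bf bg fg; rewrite -meanB//; exact: mean_le_norm. Qed.

End mean_theory.

Lemma addr_continuous (G : topologicalZmodType) (b : G) :
  continuous (fun x : G => x + b).
Proof.
move=> x; apply: (@continuous_comp _ _ _ (fun x : G => (x, b)) (fun z : G * G => z.1 + z.2)).
  by apply: cvg_pair => /=; [exact: cvg_id|exact: cvg_cst].
exact: add_continuous.
Qed.

(** * Strict positivity and Fubini for continuous functions *)

Section mean_compact.
Context {R : realType} {K : topologicalZmodType} (M : @invariant_mean R K).
Hypothesis cK : compact [set: K].
Implicit Types (f g : K -> R) (F : K * K -> R).

Local Hint Extern 0 (bounded_map _) => exact: compact_bounded_map : core.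

Lemma continuous_pairl F y : continuous F -> continuous (fun x => F (x, y)).
Proof.
move=> cF x; apply: (@continuous_comp _ _ _ (fun x => (x, y)) F); last exact: cF.
by apply: cvg_pair => /=; [exact: cvg_id|exact: cvg_cst].
Qed.

Lemma continuous_pairr F x : continuous F -> continuous (fun y => F (x, y)).
Proof.
move=> cF y; apply: (@continuous_comp _ _ _ (fun y => (x, y)) F); last exact: cF.
by apply: cvg_pair => /=; [exact: cvg_cst|exact: cvg_id].
Qed.

Lemma bounded_mapl F y : continuous F -> bounded_map (fun x => F (x, y)).
Proof. by move=> cF; apply: compact_bounded_map => //; exact: continuous_pairl. Qed.

Lemma bounded_mapr F x : continuous F -> bounded_map (fun y => F (x, y)).
Proof. by move=> cF; apply: compact_bounded_map => //; exact: continuous_pairr. Qed.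

Lemma mean_continuousl F : continuous F -> continuous (fun y => M (fun x => F (x, y))).
Proof.
move=> cF y; apply/cvgrPdist_le => e e0.
apply: filterS (compact_uniformly_near y cK cF e0) => z Fyz.
by apply: mean_dist; [exact: bounded_mapl..|move=> x; rewrite distrC ltW].
Qed.

(** Finitely many translates of the set where [f] exceeds [f x0 / 2] cover [K]; the corresponding
    sum of translates of [f] is at least [f x0 / 2], and all its terms have mean [M f]. *)
Lemma mean_gt0 f : continuous f -> (forall x, 0 <= f x) ->
  (exists x, 0 < f x) -> 0 < M f.
Proof.
move=> cf f0 [x0 fx0]; pose e := f x0 / 2.
have e0 : 0 < e by rewrite divr_gt0.
have cU y : nbhs y [set x | e < f (x + (x0 - y))].
  have c : continuous (fun x => f (x + (x0 - y))).
    move=> x; apply: (@continuous_comp _ _ _ (fun x => x + (x0 - y)) f); last exact: cf.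
    exact: addr_continuous.
  have := c y; rewrite /continuous_at subrKC => /cvgrPdist_lt/(_ _ e0).
  by apply: filterS => x /=; rewrite /e ltr_norml => /andP[]; lra.
have [s sP] := compact_finite_cover cK cU.
have bs y : bounded_map (fun x => f (x + (x0 - y))).
  exact/bounded_map_shift.
have : e <= M (fun x => \sum_(y <- s) f (x + (x0 - y))).
  rewrite -{1}(mean_cst M e) le_mean//; first exact: bounded_map_cst.
    by apply: bounded_map_sum => y _; exact: bs.
  move=> x; have [y ys /ltW] := sP x; rewrite (big_rem y)//= => /le_trans; apply.
  by rewrite lerDl sumr_ge0.
rewrite mean_sum// => eM; have := lt_le_trans e0 eM.
under eq_bigr do rewrite mean_shift//.
rewrite big_const_seq count_predT iter_addr_0 pmulrn_lgt0//.
rewrite lt0n; apply: contraTneq eM => s0.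
by rewrite (size0nil s0) big_nil -ltNge.
Qed.

(** [F (x, y)] is uniformly close to [F (x, c y)] with [c] of finite range. The latter is a finite
    sum of products of a function of [x] and an indicator in [y], for which exchanging the means is
    linearity. *)
Lemma mean_fubini F : continuous F ->
  M (fun y => M (fun x => F (x, y))) = M (fun x => M (fun y => F (x, y))).
Proof.
move=> cF; apply/eqP; rewrite -subr_eq0 -normr_eq0 eq_le normr_ge0 andbT.
apply/ler_addgt0Pr => e e0; rewrite add0r.
have e2 : 0 < e / 2 by rewrite divr_gt0.
have [s sP] := compact_finite_cover cK (fun y => compact_uniformly_near y cK cF e2).
have /choice[c cP] y : exists z, z \in s /\ forall x, `|F (x, y) - F (x, z)| < e / 2.
  by have [z zs zP] := sP y; exists z.
pose ind z y : R := (c y == z)%:R.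
have bind z : bounded_map (ind z).
  by exists 1 => y; rewrite /ind; case: eqP => _; rewrite ?normr1// normr0.
have GE x y : F (x, c y) = \sum_(z <- undup s) ind z y * F (x, z).
  rewrite (bigD1_seq (c y)) ?undup_uniq ?mem_undup//=; last by have [] := cP y.
  rewrite {1}/ind eqxx mul1r big1 ?addr0// => z zc.
  by rewrite /ind eq_sym (negbTE zc) mul0r.
have bsl y : bounded_map (fun x => \sum_(z <- undup s) ind z y * F (x, z)).
  by apply: bounded_map_sum => z _; apply: bounded_mapZ; exact: bounded_mapl.
have bsr x : bounded_map (fun y => \sum_(z <- undup s) ind z y * F (x, z)).
  by apply: bounded_map_sum => z _; apply: bounded_mapM => //; exact: bounded_map_cst.
have I1 y : M (fun x => F (x, c y)) = \sum_(z <- undup s) ind z y * M (fun x => F (x, z)).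
  under [X in M X]eq_fun do rewrite GE.
  rewrite mean_sum => [|z _]; last by apply: bounded_mapZ; exact: bounded_mapl.
  by apply: eq_bigr => z _; rewrite meanZ//; exact: bounded_mapl.
have I2 x : M (fun y => F (x, c y)) = \sum_(z <- undup s) M (ind z) * F (x, z).
  under [X in M X]eq_fun do rewrite GE.
  rewrite mean_sum => [|z _]; last first.
    by apply: bounded_mapM => //; exact: bounded_map_cst.
  apply: eq_bigr => z _; under [X in M X]eq_fun do rewrite mulrC.
  by rewrite meanZ// mulrC.
have II : M (fun y => M (fun x => F (x, c y))) = M (fun x => M (fun y => F (x, c y))).
  under [X in M X]eq_fun do rewrite I1.
  under [X in _ = M X]eq_fun do rewrite I2.
  rewrite mean_sum => [|z _]; last by apply: bounded_mapM => //; exact: bounded_map_cst.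
  rewrite mean_sum => [|z _]; last by apply: bounded_mapZ; exact: bounded_mapl.
  apply: eq_bigr => z _; rewrite meanZ; last exact: bounded_mapl.
  under [X in M X]eq_fun do rewrite mulrC.
  by rewrite meanZ// mulrC.
have bM y : bounded_map (fun x => F (x, y)) by exact: bounded_mapl.
have bl : bounded_map (fun y => M (fun x => F (x, y))).
  by apply: compact_bounded_map => //; exact: mean_continuousl.
have br : bounded_map (fun x => M (fun y => F (x, y))).
  apply: compact_bounded_map => //; apply: (@mean_continuousl (fun z => F (z.2, z.1))).
  move=> z; apply: (@continuous_comp _ _ _ (fun z : K * K => (z.2, z.1)) F); last exact: cF.
  by apply: cvg_pair => /=; [exact: cvg_snd|exact: cvg_fst].
rewrite (_ : _ - _ = (M (fun y => M (fun x => F (x, y))) - M (fun y => M (fun x => F (x, c y))))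
  - (M (fun x => M (fun y => F (x, y))) - M (fun x => M (fun y => F (x, c y))))); last first.
  by rewrite II opprB addrA subrK.
rewrite (splitr e) (le_trans (ler_normB _ _))// lerD//; apply: mean_dist => //.
- under eq_fun do rewrite I1.
  by apply: bounded_map_sum => z _; apply: bounded_mapM => //; exact: bounded_map_cst.
- by move=> y; apply: mean_dist => // x; apply: ltW; have [] := cP y.
- under eq_fun do rewrite I2.
  by apply: bounded_map_sum => z _; exact: bounded_mapZ.
- move=> x; apply: mean_dist => [||y]; first exact: bounded_mapr.
    by under eq_fun do rewrite GE.
  by apply: ltW; have [] := cP y.
Qed.

End mean_compact.

(** * Power iteration for symmetric convolution kernels *)

(** The ratios [r n] of consecutive terms are nondecreasing by log-convexity and bounded by [t 0];
    [rho] is their limit. Then [t n / rho ^+ n] is nonincreasing, and it stays above [rho]: let [i]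
    tend to infinity in [r i ^+ n.+1 * t i <= t (i + n).+1 <= t i * t n]. *)
Lemma log_convex_growth (R : realType) (t : R^nat) :
  (forall n, 0 < t n) -> (forall n, t n.+1 ^+ 2 <= t n * t n.+2) ->
  (forall i j, t (i + j).+1 <= t i * t j) ->
  exists rho q : R, [/\ 0 < rho, 0 < q & (fun n => t n / rho ^+ n) @ \oo --> q].
Proof.
move=> t0 tt tM; pose r n := t n.+1 / t n.
have r0 n : 0 < r n by rewrite divr_gt0.
have rS n : r n <= r n.+1.
  rewrite /r ler_pdivrMr// mulrAC ler_pdivlMr// -expr2.
  by rewrite (le_trans (tt n))// mulrC.
have r_ub n : r n <= t 0%N by rewrite /r ler_pdivrMr// mulrC -{1}(addn0 n).
have cr : cvgn r.
  apply: nondecreasing_is_cvgn.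
    by apply/nondecreasing_seqP.
  by exists (t 0%N) => _ [n _ <-].
pose rho := limn r.
have r_rho n : r n <= rho by apply: nondecreasing_cvgn_le => //; exact/nondecreasing_seqP.
have rho0 : 0 < rho by exact: lt_le_trans (r0 0%N) (r_rho 0%N).
have r_pow i n : r i ^+ n * t i <= t (i + n)%N.
  elim: n => [|n IH]; first by rewrite expr0 mul1r addn0.
  rewrite exprS -mulrA (le_trans (ler_wpM2l (ltW (r0 i)) IH))// addnS.
  have : r i <= r (i + n)%N.
    elim: n {IH} => [|n IH]; first by rewrite addn0.
    by rewrite addnS (le_trans IH).
  by rewrite /r ler_pdivlMr.
have t_pow n : rho ^+ n.+1 <= t n.
  apply: (@cvgr_to_le _ \oo _ _ (fun i => r i ^+ n.+1)).
    apply: (@continuous_cvg _ _ _ _ _ r (fun x => x ^+ n.+1) rho _ cr).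
    exact: exprn_continuous.
  apply: nearW => i; have := le_trans (r_pow i n.+1) _.
  move=> /(_ _ (eq_ind _ (fun k => t k <= _) (tM i n) _ (esym (addnS i n)))).
  by rewrite mulrC ler_pM2l.
pose q n := t n / rho ^+ n.
have qS n : q n.+1 <= q n.
  rewrite /q exprS invfM mulrA ler_pM2r ?invr_gt0 ?exprn_gt0//.
  by rewrite ler_pdivrMr// mulrC -ler_pdivrMr// r_rho.
have q_lb n : rho <= q n.
  by rewrite /q ler_pdivlMr ?exprn_gt0// -exprS t_pow.
have cq : cvgn q.
  apply: nonincreasing_is_cvgn; first by apply/nonincreasing_seqP.
  by exists rho => _ [n _ <-].
exists rho, (limn q); split => //.
apply: (lt_le_trans rho0); apply: limr_ge => //.
by apply: nearW.
Qed.

Lemma continuous_mul (R : realType) (T : topologicalType) (f g : T -> R) :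
  continuous f -> continuous g -> continuous (fun x => f x * g x).
Proof. by move=> cf cg x; apply: continuousM; [exact: cf|exact: cg]. Qed.

Lemma continuous_scale (R : realType) (T : topologicalType) (c : R) (f : T -> R) :
  continuous f -> continuous (fun x => c * f x).
Proof. by move=> cf; apply: continuous_mul => //; exact: cst_continuous. Qed.

Lemma continuous_add (R : realType) (T : topologicalType) (f g : T -> R) :
  continuous f -> continuous g -> continuous (fun x => f x + g x).
Proof. by move=> cf cg x; apply: continuousD; [exact: cf|exact: cg]. Qed.

Lemma translate_continuous (R : realType) (K : topologicalZmodType) (f : K -> R) a :
  continuous f -> continuous (fun x => f (x + a)).
Proof.
move=> cf x; apply: (@continuous_comp _ _ _ (fun x => x + a) f); last exact: cf.
exact: addr_continuous.
Qed.

Section hankel_operator.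
Context {R : realType} {K : topologicalZmodType} (M : @invariant_mean R K).
Hypothesis cK : compact [set: K].
Variable v : K -> R.
Hypothesis cv : continuous v.
Implicit Types (f g : K -> R).

Local Notation bcont := (compact_bounded_map cK).

Definition dot f g : R := M (fun x => f x * g x).

Definition hankel g z : R := M (fun x => v (z + x) * g x).

Lemma bounded_mapMc f g : continuous f -> continuous g -> bounded_map (fun x => f x * g x).
Proof. by move=> cf cg; apply: bcont; exact: continuous_mul. Qed.

Lemma dotC f g : dot f g = dot g f.
Proof. by rewrite /dot; under [X in M X]eq_fun do rewrite mulrC. Qed.

Lemma dotDl f g h : continuous f -> continuous g -> continuous h ->
  dot (fun x => f x + g x) h = dot f h + dot g h.
Proof.
move=> cf cg ch; rewrite /dot; under [X in M X]eq_fun do rewrite mulrDl.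
by rewrite meanD//; exact: bounded_mapMc.
Qed.

Lemma dotZl c f g : continuous f -> continuous g ->
  dot (fun x => c * f x) g = c * dot f g.
Proof.
move=> cf cg; rewrite /dot; under [X in M X]eq_fun do rewrite -mulrA.
by rewrite meanZ//; exact: bounded_mapMc.
Qed.

Lemma dot_ge0 f : continuous f -> 0 <= dot f f.
Proof.
by move=> cf; apply: mean_ge0 => [|x]; [exact: bounded_mapMc|rewrite -expr2 sqr_ge0].
Qed.

Lemma dot_gt0 f z : continuous f -> f z != 0 -> 0 < dot f f.
Proof.
move=> cf fz; apply: mean_gt0 => //; first exact: continuous_mul.
  by move=> x; rewrite -expr2 sqr_ge0.
by exists z; rewrite -expr2 exprn_even_gt0.
Qed.

Lemma dot_combination (a b : R) f g : continuous f -> continuous g ->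
  let h x := a * f x + b * g x in
  dot h h = a ^+ 2 * dot f f + 2 * (a * b) * dot f g + b ^+ 2 * dot g g.
Proof.
move=> cf cg /=.
have caf := continuous_scale (c := a) cf; have cbg := continuous_scale (c := b) cg.
have ch := continuous_add caf cbg.
rewrite dotDl// !dotZl// !(dotC _ (fun x => _ + _)) !dotDl// !dotZl//.
by rewrite (dotC g f); ring.
Qed.

Lemma dot_cauchy_schwarz f g : continuous f -> continuous g ->
  dot f g ^+ 2 <= dot f f * dot g g.
Proof.
move=> cf cg; have [g0|g0] := leP (dot g g) 0.
  have gg : dot g g = 0 by apply/eqP; rewrite eq_le g0 dot_ge0.
  have [->|fg0] := eqVneq (dot f g) 0; first by rewrite expr0n gg mulr0.
  (* With [dot g g = 0] the form is affine in [b]; this value makes it [-1]. *)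
  pose b := - (dot f f + 1) / (2 * dot f g).
  have := @dot_ge0 (fun x => 1 * f x + b * g x) (continuous_add (continuous_scale cf) (continuous_scale cg)).
  rewrite dot_combination// gg mulr0 addr0 expr1n !mul1r /b.
  rewrite (_ : 2 * _ * _ = - (dot f f + 1)); last by field.
  by rewrite opprD addrA subrr add0r oppr_ge0 ler10.
(* The squared norm of this combination is [dot g g] times the Cauchy-Schwarz defect. *)
have := @dot_ge0 (fun x => dot g g * f x + (- dot f g) * g x)
  (continuous_add (continuous_scale cf) (continuous_scale cg)).
rewrite dot_combination//.
rewrite (_ : _ + _ = dot g g * (dot f f * dot g g - dot f g ^+ 2)); last by ring.
by rewrite pmulr_rge0// subr_ge0.
Qed.

Lemma dot_shift a f g : continuous f -> continuous g ->
  dot (fun x => f (x + a)) (fun x => g (x + a)) = dot f g.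
Proof. by move=> cf cg; exact: (mean_shift M a (bounded_mapMc cf cg)). Qed.

Lemma hankel_kernel_continuous g : continuous g ->
  continuous (fun p : K * K => v (p.2 + p.1) * g p.1).
Proof.
move=> cg; apply: continuous_mul => p.
  apply: (@continuous_comp _ _ _ (fun p : K * K => (p.2, p.1)) (fun z => v (z.1 + z.2))).
    by apply: cvg_pair => /=; [exact: cvg_snd|exact: cvg_fst].
  apply: (@continuous_comp _ _ _ (fun z : K * K => z.1 + z.2) v); last exact: cv.
  exact: add_continuous.
by apply: (@continuous_comp _ _ _ fst g); [exact: cvg_fst|exact: cg].
Qed.

Lemma hankel_continuous g : continuous g -> continuous (hankel g).
Proof.
by move=> cg; exact: (mean_continuousl cK (hankel_kernel_continuous cg)).
Qed.

Lemma hankel_bounded z g : continuous g -> bounded_map (fun x => v (z + x) * g x).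
Proof. by move=> cg; exact: (bounded_mapl cK z (hankel_kernel_continuous cg)). Qed.

Lemma hankelD f g : continuous f -> continuous g ->
  hankel (fun x => f x + g x) = fun z => hankel f z + hankel g z.
Proof.
move=> cf cg; apply/funext => z; rewrite /hankel.
by under [X in M X]eq_fun do rewrite mulrDr; rewrite meanD//; exact: hankel_bounded.
Qed.

Lemma hankelZ c g : continuous g ->
  hankel (fun x => c * g x) = fun z => c * hankel g z.
Proof.
move=> cg; apply/funext => z; rewrite /hankel.
by under [X in M X]eq_fun do rewrite mulrCA; rewrite meanZ//; exact: hankel_bounded.
Qed.

(** The kernel sees only [z + x], so a translation of [g] reappears reversed. *)
Lemma hankel_shift a g : continuous g ->
  hankel (fun x => g (x + a)) = fun z => hankel g (z - a).
Proof.
move=> cg; apply/funext => z; rewrite /hankel.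
rewrite -(mean_shift M a (hankel_bounded (z - a) cg)).
by congr (M _); apply/funext => x; rewrite [x + a]addrC addrA subrK.
Qed.

Lemma hankel_sym f g : continuous f -> continuous g ->
  dot (hankel f) g = dot f (hankel g).
Proof.
move=> cf cg; pose F p : R := v (p.2 + p.1) * f p.1 * g p.2.
have cF : continuous F.
  apply: continuous_mul; first exact: hankel_kernel_continuous.
  by move=> p; apply: (@continuous_comp _ _ _ snd g); [exact: cvg_snd|exact: cg].
transitivity (M (fun z => M (fun x => F (x, z)))).
  congr (M _); apply/funext => z; rewrite mulrC -meanZ; last exact: hankel_bounded.
  by congr (M _); apply/funext => x; rewrite /F mulrC.
rewrite mean_fubini//; congr (M _); apply/funext => x.
rewrite -meanZ; last exact: hankel_bounded.
by congr (M _); apply/funext => z; rewrite /F /= [z + x]addrC; ring.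
Qed.

(** Cauchy-Schwarz against a translate of [v], whose norm does not depend on [z]. *)
Lemma hankel_sqr_le z g : continuous g -> hankel g z ^+ 2 <= dot v v * dot g g.
Proof.
move=> cg; pose w x := v (x + z).
have cw : continuous w by exact: translate_continuous.
rewrite -(dot_shift z cv cv) -/w.
rewrite (_ : hankel g z = dot w g); first exact: dot_cauchy_schwarz.
by congr (M _); apply/funext => x; rewrite /w addrC.
Qed.

Lemma hankel_norm_le B g C : 0 <= B -> 0 <= C -> (forall x, `|v x| <= B) ->
  (forall x, `|g x| <= C) -> forall z, `|hankel g z| <= B * C.
Proof.
by move=> B0 C0 vB gC z; apply: mean_le_norm => x; rewrite normrM ler_pM.
Qed.

Local Notation w n := (iter n hankel v).

Lemma iter_hankel_continuous n g : continuous g -> continuous (iter n hankel g).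
Proof. by move=> cg; elim: n => //= n; exact: hankel_continuous. Qed.

Lemma iter_hankel_sym n f g : continuous f -> continuous g ->
  dot (iter n hankel f) g = dot f (iter n hankel g).
Proof.
move=> cf; elim: n g => //= n IH g cg.
rewrite hankel_sym//; last exact: iter_hankel_continuous.
by rewrite IH -?iterSr//; exact: hankel_continuous.
Qed.

Lemma iter_hankel_shift n a g : continuous g ->
  exists b, iter n hankel (fun x => g (x + a)) = fun x => iter n hankel g (x + b).
Proof.
move=> cg; elim: n => [|n [b IH]]; first by exists a.
by exists (- b); rewrite /= IH hankel_shift//; exact: iter_hankel_continuous.
Qed.

Lemma dot_iter i j : dot (w i) (w j) = dot v (w (i + j)%N).
Proof.
rewrite iter_hankel_sym//; last exact: iter_hankel_continuous.
by rewrite iterD.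
Qed.

(** By symmetry these even moments are the squared norms of the [w n], and Cauchy-Schwarz makes them
    log-convex. *)
Let t n := dot v (w n.*2).

(** An odd iterate at [z] is the pairing of a translate of [v] with [w j.*2]. Moving [j] of the
    operators to the left gives a translate of [w j] paired with [w j], bounded by
    Cauchy-Schwarz. *)
Lemma iter_hankel_le j z : `|w j.*2.+1 z| <= t j.
Proof.
have cw n : continuous (w n) by exact: iter_hankel_continuous.
have cz : continuous (fun x => v (x + z)) by exact: translate_continuous.
have tj : t j = dot (w j) (w j) by rewrite dot_iter addnn.
have [b bE] := iter_hankel_shift j z cv.
have -> : w j.*2.+1 z = dot (fun x => w j (x + b)) (w j).
  rewrite -bE iter_hankel_sym// -iterD addnn.
  by rewrite /= /hankel /dot; congr (M _); apply/funext => x; rewrite addrC.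
rewrite -ler_sqr ?nnegrE ?normr_ge0//; last by rewrite tj dot_ge0.
rewrite real_normK ?num_real// (le_trans (dot_cauchy_schwarz _ _))//.
  exact: translate_continuous.
by rewrite dot_shift// -tj expr2.
Qed.

(** The normalized odd iterates [h n] are images under the operator, so the square of
    [h m z - h n z] is at most [t 0] times [qn m.*2 + qn n.*2 - 2 * qn (m + n)], which tends to 0 as
    [qn] converges. The limit is nonzero because [h n 0 = qn n] tends to [q > 0]. *)
Lemma hankel_eigenfunction : v 0 != 0 ->
  exists (rho : R) (e : K -> R), [/\ 0 < rho, continuous e, e 0 != 0 &
    hankel (hankel e) = fun z => rho * e z].
Proof.
move=> v0.
have cw n : continuous (w n) by exact: iter_hankel_continuous.
have tEE n : t n = dot (w n) (w n) by rewrite dot_iter addnn.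
have t0 : 0 < t 0%N by rewrite tEE; exact: dot_gt0 v0.
have tC n : t n.+1 ^+ 2 <= t n * t n.+2.
  have := dot_cauchy_schwarz (cw n) (cw n.+2); rewrite -!tEE dot_iter.
  by rewrite (_ : (n + n.+2)%N = n.+1.*2)// -addnn !addnS.
(* [w 1] takes the value [dot v v] at 0; positivity of the later moments then follows by
   log-convexity. *)
have t1 : 0 < t 1%N.
  rewrite tEE; apply: (@dot_gt0 (w 1) 0) => //; rewrite gt_eqF//.
  rewrite (_ : w 1 0 = t 0%N)//= /hankel /t /dot.
  by congr (M _); apply/funext => x; rewrite add0r.
have tn n : 0 < t n.
  suff [] : 0 < t n /\ 0 < t n.+1 by [].
  elim: n => // n [tn tn1]; split=> //.
  have := lt_le_trans (exprn_gt0 2 tn1) (tC n).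
  by rewrite pmulr_rgt0.
have tM i j : t (i + j).+1 <= t i * t j.
  rewrite /t (_ : (i + j).+1.*2 = (i.*2.+1 + j.*2.+1)%N); last by rewrite doubleS doubleD addnS.
  rewrite -dot_iter (le_trans (ler_norm _))//; apply: mean_le_norm => x.
  by rewrite normrM ler_pM// iter_hankel_le.
have [rho [q [rho0 q0 cq]]] := log_convex_growth tn tC tM.
exists rho.
pose qn n := t n / rho ^+ n.
pose h n z := (rho ^+ n)^-1 * w n.*2.+1 z.
have ch n : continuous (h n).
  exact: continuous_scale.
have hE n : h n = hankel (fun x => (rho ^+ n)^-1 * w n.*2 x) by rewrite hankelZ.
have hD m n z : (h m z - h n z) ^+ 2 <= t 0%N * (qn m.*2 + qn n.*2 - 2 * qn (m + n)%N).
  have cm : continuous (fun x => (rho ^+ m)^-1 * w m.*2 x).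
    exact: continuous_scale.
  have cn : continuous (fun x => (- (rho ^+ n)^-1) * w n.*2 x).
    exact: continuous_scale.
  rewrite (_ : h m z - h n z = hankel (fun x => (rho ^+ m)^-1 * w m.*2 x +
      (- (rho ^+ n)^-1) * w n.*2 x) z); last first.
    by rewrite hankelD// !hankelZ// mulNr.
  rewrite (le_trans (hankel_sqr_le _ _))//; first exact: continuous_add.
  rewrite dot_combination// !dot_iter addnn -doubleD addnn.
  rewrite le_eqVlt; apply/orP; left; apply/eqP; congr (_ * _).
  rewrite /qn /t -!addnn !exprD !invfM; ring.
have hC (e : R) : 0 < e ->
    exists N, forall m n, (N <= m)%N -> (N <= n)%N -> forall z, `|h m z - h n z| <= e.
  move=> e0.
  (* The bound of [hD] is at most [t 0 * (4 * d)] once each [qn] is within [d] of [q]. *)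
  pose d := e ^+ 2 / (4 * t 0%N).
  have d0 : 0 < d by rewrite divr_gt0 ?exprn_gt0// mulr_gt0.
  have /cvgrPdist_le/(_ _ d0)[N _ NP] := cq.
  exists N => m n Nm Nn z.
  rewrite -ler_sqr ?nnegrE ?normr_ge0// ?(ltW e0)// real_normK ?num_real//.
  rewrite (le_trans (hD m n z))// mulrC -ler_pdivlMr//.
  have dE : e ^+ 2 / t 0%N = 4 * d by rewrite /d; field; rewrite gt_eqF.
  have : `|q - qn m.*2| <= d by apply: NP => /=; rewrite -addnn (leq_trans Nm)// leq_addr.
  have : `|q - qn n.*2| <= d by apply: NP => /=; rewrite -addnn (leq_trans Nn)// leq_addr.
  have : `|q - qn (m + n)%N| <= d by apply: NP => /=; rewrite (leq_trans Nm)// leq_addr.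
  rewrite dE !ler_norml => /andP[? ?] /andP[? ?] /andP[? ?]; lra.
have cvh z : cvgn (h ^~ z).
  apply/cauchy_cvgP/cauchy_exP => d d0; have d2 : 0 < d / 2 by rewrite divr_gt0.
  have [N NP] := hC _ d2; exists (h N z); exists N => // n /= Nn.
  rewrite /ball /= (le_lt_trans (NP _ _ (leqnn N) Nn z))// ltr_pdivrMr//; lra.
pose e z := limn (h ^~ z).
have he (d : R) : 0 < d ->
    exists N, forall n, (N <= n)%N -> forall z, `|e z - h n z| <= d.
  move=> /hC[N NP]; exists N => n Nn z.
  apply: (@cvgr_to_le _ \oo _ _ (fun m => `|h m z - h n z|)).
    by apply: cvg_norm; apply: cvgB; [exact: cvh|exact: cvg_cst].
  by exists N => // m /= Nm; exact: NP.
have ce : continuous e.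
  move=> x; apply/cvgrPdist_le => d d0; have d3 : 0 < d / 3 by rewrite divr_gt0.
  have [N NP] := he _ d3.
  have /cvgrPdist_le/(_ _ d3) := ch N x; apply: filterS => y.
  have := NP N (leqnn N) x; have := NP N (leqnn N) y.
  rewrite !ler_norml => /andP[? ?] /andP[? ?] /andP[? ?]; lra.
have e0E : e 0 = q.
  apply: cvg_lim => //; rewrite (_ : h^~ 0 = (fun n => t n / rho ^+ n))//.
  apply/funext => n; rewrite /h mulrC; congr (_ / _).
  by rewrite /= /hankel /t /dot; congr (M _); apply/funext => x; rewrite add0r.
exists e; split => //; first by rewrite e0E gt_eqF.
apply/funext => z; apply/eqP; rewrite -subr_eq0 -normr_eq0 eq_le normr_ge0 andbT.
have [B vB] := bcont cv.
have B0 : 0 <= B by exact: le_trans (vB 0).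
have Brho : 0 < B * B + rho by rewrite ltr_wpDl// mulr_ge0.
apply/ler_addgt0Pr => d d0; rewrite add0r.
(* An error [d'] in [e] becomes at most [(B * B + rho) * d'] in the equation: two applications of
   the operator with [v] bounded by [B], and the factor [rho]. *)
have dB : 0 < d / (B * B + rho) by rewrite divr_gt0.
have [N NP] := he _ dB; set d' := d / _ in dB NP.
have hh : hankel (hankel (h N)) = (fun z => rho * h N.+1 z).
  rewrite /h hankelZ// hankelZ; last exact: hankel_continuous.
  apply/funext => y; rewrite doubleS /= mulrA exprS invfM.
  by rewrite mulrA mulfV ?gt_eqF// mul1r.
have cB f g : continuous f -> continuous g -> continuous (fun x => f x + (-1) * g x).
  by move=> cf cg; apply: continuous_add => //; apply: continuous_mul => //; exact: cst_continuous.
have -> : hankel (hankel e) z - rho * e z =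
    hankel (hankel (fun x => e x + (-1) * h N x)) z + rho * (h N.+1 z - e z).
  have cN := ch N; have cHN := hankel_continuous cN; have cHe := hankel_continuous ce.
  have cNN : continuous (fun x => (-1) * h N x).
    exact: continuous_scale.
  have cHNN : continuous (fun x => (-1) * hankel (h N) x).
    exact: continuous_scale.
  by rewrite hankelD// hankelZ// hankelD// hankelZ// hh; ring.
rewrite (_ : d = B * (B * d') + rho * d'); last by rewrite /d'; field; rewrite gt_eqF.
rewrite (le_trans (ler_normD _ _))// lerD//.
  apply: hankel_norm_le => //; first by rewrite mulr_ge0// ltW.
  apply: hankel_norm_le => //; first by rewrite ltW.
  by move=> x; rewrite mulN1r NP.
by rewrite normrM gtr0_norm// ler_pM2l// distrC NP.
Qed.

End hankel_operator.

(** * Sine and cosine on the circle *)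

Section circle_trigonometry.
Context {R : realType}.
Implicit Types (s t : circle R) (x y : R).

Lemma cos_sin_int x (n : int) :
  cos (x + pi *+ 2 * n%:~R) = cos x /\ sin (x + pi *+ 2 * n%:~R) = sin x.
Proof.
have H y (m : nat) : cos (y + pi *+ 2 * m%:R) = cos y /\ sin (y + pi *+ 2 * m%:R) = sin y.
  by rewrite mulr_natr (periodicn (@cosD2pi R)) (periodicn (@sinD2pi R)).
case: (intP n) => [|m|m]; first by rewrite mulr0 addr0.
  exact: H.
have [<- <-] := H (x + pi *+ 2 * (- m.+1%:Z)%:~R) m.+1.
by rewrite -addrA -mulrDr mulrNz addNr mulr0 addr0.
Qed.

(** With [circle_sin], the two parts of [exp (2 i pi t)]; the jump of [circle_frac] at 0 is
    invisible to periodic functions. *)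
Definition circle_cos t : R := cos (pi *+ 2 * circle_frac t).
Definition circle_sin t : R := sin (pi *+ 2 * circle_frac t).

Lemma circle_frac_pi x : exists n : int, circle_frac (circle_pi x) = x + n%:~R.
Proof.
have /circle_piP/intrP[n xn] := circle_fracK (circle_pi x).
by exists n; rewrite -xn subrKC.
Qed.

Lemma circle_cos_pi x : circle_cos (circle_pi x) = cos (pi *+ 2 * x).
Proof.
by rewrite /circle_cos; have [n ->] := circle_frac_pi x; rewrite mulrDr (cos_sin_int _ n).1.
Qed.

Lemma circle_sin_pi x : circle_sin (circle_pi x) = sin (pi *+ 2 * x).
Proof.
by rewrite /circle_sin; have [n ->] := circle_frac_pi x; rewrite mulrDr (cos_sin_int _ n).2.
Qed.

Lemma circle_cosD s t : circle_cos (s + t) =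
  circle_cos s * circle_cos t - circle_sin s * circle_sin t.
Proof.
have [x <-] := circle_pi_surj s; have [y <-] := circle_pi_surj t.
by rewrite -circle_piD !circle_cos_pi !circle_sin_pi mulrDr cosD.
Qed.

Lemma circle_sinD s t : circle_sin (s + t) =
  circle_sin s * circle_cos t + circle_cos s * circle_sin t.
Proof.
have [x <-] := circle_pi_surj s; have [y <-] := circle_pi_surj t.
by rewrite -circle_piD !circle_cos_pi !circle_sin_pi mulrDr sinD.
Qed.

Lemma circle_pi0 : circle_pi 0 = 0 :> circle R.
Proof. by rewrite -(subrr 0) circle_piB subrr. Qed.

Lemma circle_cos0 : circle_cos 0 = 1.
Proof. by rewrite -circle_pi0 circle_cos_pi mulr0 cos0. Qed.

Lemma circle_sin0 : circle_sin 0 = 0.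
Proof. by rewrite -circle_pi0 circle_sin_pi mulr0 sin0. Qed.

Lemma circle_cosN t : circle_cos (- t) = circle_cos t.
Proof.
have [x <-] := circle_pi_surj t.
by rewrite -[- _]add0r -circle_pi0 -circle_piB !circle_cos_pi add0r mulrN cosN.
Qed.

Lemma circle_sinN t : circle_sin (- t) = - circle_sin t.
Proof.
have [x <-] := circle_pi_surj t.
by rewrite -[- _]add0r -circle_pi0 -circle_piB !circle_sin_pi add0r mulrN sinN.
Qed.

Lemma circle_cos2Dsin2 t : circle_cos t ^+ 2 + circle_sin t ^+ 2 = 1.
Proof. exact: cos2Dsin2. Qed.

Lemma circle_cos_continuous : continuous circle_cos.
Proof.
apply/continuousP => W oW; rewrite circle_openE.
rewrite (_ : _ @^-1` _ = (fun x : R => cos (pi *+ 2 * x)) @^-1` W); last first.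
  by apply/funext => x; rewrite /preimage /= circle_cos_pi.
have /continuousP : continuous (fun x : R => cos (pi *+ 2 * x)); last exact.
move=> x; apply: (@continuous_comp _ _ _ (fun x => pi *+ 2 * x) cos).
  exact: mulrl_continuous.
exact: continuous_cos.
Qed.

Lemma circle_cos_eq1 t : circle_cos t = 1 -> t = 0.
Proof.
rewrite /circle_cos => c1; have /andP[f0 f1] := circle_frac_itv t.
rewrite -(circle_fracK t) -circle_pi0; congr circle_pi.
have pi0 := pi_gt0 R.
have pi2 : 0 < pi *+ 2 :> R by rewrite mulrn_wgt0.
have in0 : (0 : R) \in `[0, pi] by rewrite in_itv /= lexx ltW.
have pi2_itv (x : R) : 0 <= x <= 2^-1 -> pi *+ 2 * x \in `[0, pi].
  move=> /andP[x0 x2]; rewrite in_itv; apply/andP; split.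
    by apply: mulr_ge0 => //; apply: mulrn_wge0; exact: ltW.
  have : pi * (2 * x) <= pi by apply: ler_piMr; [exact: ltW|lra].
  by rewrite mulrA mulr_natr.
have [fh|fh] := leP (circle_frac t) (2^-1).
  have /eqP : pi *+ 2 * circle_frac t = 0.
    apply: (cos_inj _ in0); first by apply: pi2_itv; rewrite f0.
    by rewrite cos0.
  by rewrite mulf_eq0 (gt_eqF pi2) => /eqP.
(* Past half a turn the angle leaves the interval where cosine is injective; the reflected angle is
   used, which cannot vanish as [circle_frac t < 1]. *)
exfalso; suff /eqP : pi *+ 2 * (1 - circle_frac t) = 0.
  by rewrite mulf_eq0 (gt_eqF pi2) subr_eq0 gt_eqF.
apply: (cos_inj _ in0); first by apply: pi2_itv; lra.
rewrite cos0 -[RHS]c1 mulrBr mulr1 -cosN opprB.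
by rewrite -(@cosD2pi R (_ - _)) subrK.
Qed.

(** The cosine of [s - t] expands to [cos^2 + sin^2 = 1]. *)
Lemma circle_cos_sin_inj s t :
  circle_cos s = circle_cos t -> circle_sin s = circle_sin t -> s = t.
Proof.
move=> cst sst; apply/eqP; rewrite -subr_eq0; apply/eqP/circle_cos_eq1.
by rewrite circle_cosD circle_cosN circle_sinN mulrN opprK cst sst -!expr2 circle_cos2Dsin2.
Qed.

Lemma circle_cos_sin_surj x y : x ^+ 2 + y ^+ 2 = 1 ->
  exists t, circle_cos t = x /\ circle_sin t = y.
Proof.
move=> xy1.
have x1 : -1 <= x <= 1.
  rewrite -ler_norml -ler_sqr ?nnegrE// real_normK ?num_real// expr1n -xy1.
  by rewrite lerDl sqr_ge0.
have xI : x \in `[-1, 1] by rewrite in_itv.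
have pi0 := pi_gt0 R.
have pi2 : 0 < pi *+ 2 :> R by rewrite mulrn_wgt0.
have key (z : R) : pi *+ 2 * (z / (pi *+ 2)) = z.
  by rewrite mulrC divfK// gt_eqF.
have yE : Num.sqrt (1 - x ^+ 2) = `|y| by rewrite -xy1 addrAC subrr add0r sqrtr_sqr.
have [y0|y0] := leP 0 y.
  exists (circle_pi (acos x / (pi *+ 2))).
  by rewrite circle_cos_pi circle_sin_pi key (acosK xI) (sin_acos x1) yE ger0_norm.
exists (circle_pi (- acos x / (pi *+ 2))).
by rewrite circle_cos_pi circle_sin_pi key cosN sinN (acosK xI) (sin_acos x1) yE ltr0_norm// opprK.
Qed.

(* Near 1 the angle is recovered by arctan, which makes the character continuous
   at 0, hence everywhere. *)
Lemma character_of_cos_sin (K : topologicalZmodType) (c s : K -> R) :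
  continuous c -> continuous s ->
  (forall a, c a ^+ 2 + s a ^+ 2 = 1) ->
  (forall a b, c (a + b) = c a * c b - s a * s b) ->
  (forall a b, s (a + b) = s a * c b + c a * s b) ->
  exists chi : pdual R K, forall a, circle_cos (chi a) = c a /\ circle_sin (chi a) = s a.
Proof.
move=> cc cs cs1 cD sD.
have /choice[f fP] a : exists t, circle_cos t = c a /\ circle_sin t = s a.
  exact: circle_cos_sin_surj.
have fD : {morph f : x y / x + y}.
  move=> a b; have [ca sa] := fP a; have [cb sb] := fP b; have [cab sab] := fP (a + b).
  by apply: circle_cos_sin_inj; rewrite ?cab ?sab ?circle_cosD ?circle_sinD ca cb sa sb.
have f0 : f 0 = 0 by apply: (addIr (f 0)); rewrite -fD !add0r.
have c0 : c 0 = 1 by rewrite -(fP 0).1 f0 circle_cos0.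
have s0 : s 0 = 0 by rewrite -(fP 0).2 f0 circle_sin0.
have pi0 := pi_gt0 R.
have pi2 : 0 < pi *+ 2 :> R by rewrite mulrn_wgt0.
have key (z : R) : pi *+ 2 * (z / (pi *+ 2)) = z.
  by rewrite mulrC divfK// gt_eqF.
have fnear : \forall a \near (0 : K), circle_pi (atan (s a / c a) / (pi *+ 2)) = f a.
  have /cvgrPdist_lt/(_ _ ltr01) := cc 0; rewrite c0; apply: filterS => a.
  rewrite ltr_norml => /andP[_ ca1]; have ca0 : 0 < c a by lra.
  have [fc fs] := fP a.
  have cE : cos (atan (s a / c a)) = c a.
    rewrite cos_atan (_ : 1 + _ = (c a)^-1 ^+ 2); last first.
      have sE : s a ^+ 2 = 1 - c a ^+ 2 by rewrite -(cs1 a) addrAC subrr add0r.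
    by rewrite expr_div_n sE; field; rewrite gt_eqF.
    by rewrite sqrtr_sqr ger0_norm ?invrK// invr_ge0 ltW.
  apply: circle_cos_sin_inj; rewrite ?circle_cos_pi ?circle_sin_pi key ?fc ?fs// ?cE//.
  have := atanK (s a / c a); rewrite /tan cE => /(congr1 ( *%R^~ (c a))).
  by rewrite !divfK ?gt_eqF.
have cf0 : {for 0, continuous f}.
  rewrite /continuous_at /prop_for.
  apply: (cvg_trans (near_eq_cvg fnear)).
  have -> : f 0 = circle_pi (atan (s 0 / c 0) / (pi *+ 2)).
    by rewrite s0 mul0r atan0 mul0r circle_pi0.
  apply: (@continuous_cvg _ _ _ _ _ (fun a => atan (s a / c a) / (pi *+ 2)) (@circle_pi R)).
    exact: circle_pi_continuous.
  apply: cvgMl; apply: (@continuous_cvg _ _ _ _ _ (fun a => s a / c a) atan).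
    exact: continuous_atan.
  apply: cvgM; first exact: cs.
  by apply: cvgV; [rewrite c0|exact: cc].
have fcont : continuous f.
  move=> a.
  have -> : f = (fun z => z + f a) \o (f \o (fun y : K => y - a)).
    by apply/funext => y; rewrite /= -fD subrK.
  apply: continuous_comp; last exact: addr_continuous.
  apply: continuous_comp; first exact: addr_continuous.
  by rewrite subrr.
by exists (PDual fD fcont).
Qed.

End circle_trigonometry.

(** * Characters separate points *)

(** Let [W] be a nonzero common stable subspace of least rank. It contains an eigenvector of each
    [B i], and by commutation the eigenspace meets [W] in a stable subspace, hence in all of [W]. So
    every nonzero vector of [W] is a common eigenvector, even for an infinite family. *)
Lemma common_eigenvector_family (C : numClosedFieldType) (I : Type) n (B : I -> 'M[C]_n) :
  (0 < n)%N -> (forall i j, comm_mx (B i) (B j)) ->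
  exists2 v : 'rV_n, v != 0 & forall i, exists a, v *m B i = a *: v.
Proof.
move=> n0 BB.
pose P r := `[< exists W : 'M[C]_n,
  [/\ \rank W = r, W != 0 & forall i, stablemx W (B i)] >].
have exP : exists r, P r.
  exists n; apply/asboolP; exists 1%:M; split; first exact: mxrank1.
    by rewrite -mxrank_eq0 mxrank1 -lt0n.
  by move=> i; rewrite submx1.
have [_ /asboolP[W [<- W0 WB]] Wmin] := ex_minnP exP.
exists (nz_row W); first by rewrite nz_row_eq0.
(* [X] is the matrix of [B i] restricted to [W], in the basis [row_base W]. *)
move=> i; pose X := row_base W *m B i *m pinvmx (row_base W).
have XE : X *m row_base W = row_base W *m B i.
  by rewrite /X mulmxKpV// stablemx_row_base.
have [a /eigenvalueP[v vX v0]] : exists a, eigenvalue X a.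
  by apply: eigenvalue_closed; rewrite lt0n mxrank_eq0.
exists a; pose V := (W :&: eigenspace (B i) a)%MS.
have WV : (\rank W <= \rank V)%N.
  apply/Wmin/asboolP; exists V; split => //; last first.
    move=> j; rewrite sub_capmx; apply/andP; split.
      by rewrite (submx_trans (submxMr _ (capmxSl _ _)))//; exact: WB.
    rewrite (submx_trans (submxMr _ (capmxSr _ _)))//.
    exact: comm_mx_stable_eigenspace.
  apply: contraNneq v0 => V0.
  have : (v *m row_base W <= V)%MS.
    rewrite sub_capmx (submx_trans (submxMl _ _)) ?eq_row_base//=.
    by apply/eigenspaceP; rewrite -mulmxA -XE mulmxA vX scalemxAl.
  by rewrite V0 submx0 mulmx_free_eq0 ?row_base_free.
have : (W <= V)%MS by rewrite -(geq_leqif (mxrank_leqif_sup (capmxSl W _))).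
rewrite sub_capmx => /andP[_ WE]; apply/eigenspaceP.
exact: submx_trans (nz_row_sub _) WE.
Qed.

(** * Finite dimension of the eigenspaces *)

Section hankel_eigenspace.
Context {R : realType} {K : topologicalZmodType} (M : @invariant_mean R K).
Hypothesis cK : compact [set: K].
Variables (v : K -> R) (rho : R).
Hypotheses (cv : continuous v) (rho0 : 0 < rho).
Implicit Types (f g : K -> R).

Local Notation H := (hankel M v).
Local Notation "<< f , g >>" := (dot M f g).

Definition hankel_eigen f := continuous f /\ H (H f) = fun z => rho * f z.

Lemma hankel_eigenD f g : hankel_eigen f -> hankel_eigen g ->
  hankel_eigen (fun x => f x + g x).
Proof.
move=> [cf fE] [cg gE]; split; first exact: continuous_add.
rewrite hankelD// hankelD//; [|exact: hankel_continuous..].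
by apply/funext => z; rewrite fE gE mulrDr.
Qed.

Lemma hankel_eigenZ c f : hankel_eigen f -> hankel_eigen (fun x => c * f x).
Proof.
move=> [cf fE]; split; first exact: continuous_scale.
rewrite hankelZ// hankelZ//; last exact: hankel_continuous.
by apply/funext => z; rewrite fE mulrCA.
Qed.

Lemma hankel_eigen_sum m (c : 'I_m -> R) (g : 'I_m -> K -> R) :
  (forall i, hankel_eigen (g i)) -> hankel_eigen (fun x => \sum_(i < m) c i * g i x).
Proof.
elim: m c g => [|m IH] c g Eg.
  under [X in hankel_eigen X]eq_fun do rewrite big_ord0.
  split; first exact: cst_continuous.
  have -> : (fun=> 0 : R) = (fun x : K => 0 * (0 : R)) by rewrite mulr0.
  rewrite hankelZ//; last exact: cst_continuous.
  rewrite hankelZ//; last by apply: hankel_continuous => //; exact: cst_continuous.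
  by apply/funext => z; rewrite !mul0r mulr0.
under [X in hankel_eigen X]eq_fun do rewrite big_ord_recr/=.
apply: hankel_eigenD; last exact: hankel_eigenZ.
exact: (IH (fun i => c (widen_ord (leqnSn m) i)) (fun i => g (widen_ord (leqnSn m) i))).
Qed.

(** The two reversals of the translation cancel. *)
Lemma hankel_eigen_shift a f : hankel_eigen f -> hankel_eigen (fun x => f (x + a)).
Proof.
move=> [cf fE]; split; first exact: translate_continuous.
rewrite hankel_shift// (hankel_shift M cK cv (- a))//; last exact: hankel_continuous.
by apply/funext => z; rewrite opprK fE.
Qed.

Lemma dot_suml m (c : 'I_m -> R) (g : 'I_m -> K -> R) h :
  (forall i, continuous (g i)) -> continuous h ->
  <<(fun x => \sum_(i < m) c i * g i x), h>> = \sum_(i < m) c i * <<g i, h>>.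
Proof.
move=> cg ch; rewrite /dot; under [X in M X]eq_fun do rewrite mulr_suml.
rewrite mean_sum => [|i _].
  apply: eq_bigr => i _; under [X in M X]eq_fun do rewrite -mulrA.
  by rewrite meanZ//; exact: bounded_mapMc.
under eq_fun do rewrite -mulrA; apply: bounded_mapZ; exact: bounded_mapMc.
Qed.

Definition orthonormal_eigen m (g : 'I_m -> K -> R) :=
  (forall i, hankel_eigen (g i)) /\ (forall i j, <<g i, g j>> = (i == j)%:R).

Lemma orthonormal_residue m (g : 'I_m -> K -> R) f : orthonormal_eigen g ->
  continuous f -> forall j,
  <<(fun x => f x + (-1) * \sum_(i < m) <<f, g i>> * g i x), g j>> = 0.
Proof.
move=> [Eg gg] cf j; have cg i := (Eg i).1.
have cs : continuous (fun x => \sum_(i < m) <<f, g i>> * g i x).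
  by have [] := hankel_eigen_sum (fun i => <<f, g i>>) Eg.
rewrite dotDl//; last exact: continuous_scale.
rewrite dotZl// dot_suml//; under eq_bigr do rewrite gg.
rewrite (bigD1 j)//= eqxx mulr1 big1 => [|i ij]; last by rewrite (negbTE ij) mulr0.
by rewrite addr0 mulN1r subrr.
Qed.

Lemma bessel m (g : 'I_m -> K -> R) f : orthonormal_eigen g -> continuous f ->
  \sum_(i < m) <<f, g i>> ^+ 2 <= <<f, f>>.
Proof.
move=> og cf; have [Eg gg] := og; have cg i := (Eg i).1.
have cs : continuous (fun x => \sum_(i < m) <<f, g i>> * g i x).
  by have [] := hankel_eigen_sum (fun i => <<f, g i>>) Eg.
have cZs : continuous (fun x => (-1) * \sum_(i < m) <<f, g i>> * g i x).
  exact: continuous_scale.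
pose p x := f x + (-1) * \sum_(i < m) <<f, g i>> * g i x.
have cp : continuous p by exact: continuous_add.
have := dot_ge0 M cK cp; rewrite {1}/p dotDl// dotZl// dot_suml//.
rewrite big1 => [|i _]; last by rewrite (dotC M (g i)) orthonormal_residue// mulr0.
rewrite mulr0 addr0 (dotC M f) dotDl// dotZl// dot_suml// mulN1r subr_ge0.
by under eq_bigr do rewrite (dotC M (g _)) -expr2.
Qed.

(** By symmetry, the image under [H] of the translate of [v] by [z] has coefficient [rho * g i z]
    along [g i]. Bessel's inequality bounds the sum of the squares uniformly in [z], and taking the
    mean over [z] counts the [g i]. *)
Lemma orthonormal_eigen_size m (g : 'I_m -> K -> R) : orthonormal_eigen g ->
  m%:R * rho ^+ 2 <= <<H v, H v>>.
Proof.
move=> og; have [Eg gg] := og; have cg i := (Eg i).1.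
have cHv : continuous (H v) by exact: hankel_continuous.
have gz z : \sum_(i < m) rho ^+ 2 * (g i z * g i z) <= <<H v, H v>>.
  have cvz : continuous (fun x => v (x + z)) by exact: translate_continuous.
  rewrite -(dot_shift M cK (- z) cHv cHv) -hankel_shift//.
  have cHz : continuous (H (fun x => v (x + z))) by exact: hankel_continuous.
  rewrite (le_trans _ (bessel og cHz))// le_eqVlt; apply/orP; left; apply/eqP.
  apply: eq_bigr => i _; rewrite -expr2 -exprMn; congr (_ ^+ 2).
  rewrite hankel_sym//; have [_ /(congr1 (@^~ z)) <-] := Eg i.
  by congr (M _); apply/funext => x; rewrite addrC.
have -> : m%:R * rho ^+ 2 = M (fun z => \sum_(i < m) rho ^+ 2 * (g i z * g i z)).
  rewrite mean_sum => [|i _]; last by apply: bounded_mapZ; exact: bounded_mapMc.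
  rewrite (eq_bigr (fun=> rho ^+ 2)) => [|i _].
    by rewrite sumr_const card_ord mulr_natl.
  rewrite meanZ; last exact: bounded_mapMc.
  by have := gg i i; rewrite eqxx /dot => ->; rewrite mulr1.
rewrite -(mean_cst M <<_, _>>); apply: le_mean => //; last exact: bounded_map_cst.
by apply: bounded_map_sum => i _; apply: bounded_mapZ; exact: bounded_mapMc.
Qed.

Lemma normalize f z : hankel_eigen f -> f z != 0 ->
  exists c, hankel_eigen (fun x => c * f x) /\ <<(fun x => c * f x), (fun x => c * f x)>> = 1.
Proof.
move=> Ef fz; have cf := Ef.1; have ff := dot_gt0 M cK cf fz.
exists (Num.sqrt <<f, f>>)^-1; split; first exact: hankel_eigenZ.
have cZ := continuous_scale (c := (Num.sqrt <<f, f>>)^-1) cf.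
rewrite dotZl// dotC dotZl// mulrA -expr2 exprVn sqr_sqrtr ?(ltW ff)//.
by rewrite mulVf// gt_eqF.
Qed.

(** The size bound yields an orthonormal family of maximal length; a nonzero residue of an
    eigenfunction, once normalized, would extend it. *)
Lemma hankel_eigen_basis e z : hankel_eigen e -> e z != 0 ->
  exists m (g : 'I_m -> K -> R), [/\ (0 < m)%N, orthonormal_eigen g &
    forall f, hankel_eigen f -> forall x, f x = \sum_(i < m) <<f, g i>> * g i x].
Proof.
move=> Ee ez; pose P m := `[< exists g : 'I_m -> K -> R, orthonormal_eigen g >].
have P1 : P 1%N.
  have [c [Ec cc]] := normalize Ee ez.
  apply/asboolP; exists (fun _ x => c * e x); split => // i j.
  by rewrite !ord1 eqxx.
have Pub m : P m -> (m <= Num.truncn (<<H v, H v>> / rho ^+ 2))%N.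
  move=> /asboolP[g /orthonormal_eigen_size mle].
  rewrite truncn_ge_nat; last first.
    by rewrite divr_ge0// ?exprn_ge0 ?(ltW rho0)// dot_ge0//; exact: hankel_continuous.
  by rewrite ler_pdivlMr// exprn_gt0.
have [m /asboolP[g og] mmax] := ex_maxnP (ex_intro P 1%N P1) Pub.
exists m, g; split => //; first exact: mmax.
move=> f Ef x; apply: contrapT => fx.
have [Eg gg] := og; have cg i := (Eg i).1.
pose p x := f x + (-1) * \sum_(i < m) <<f, g i>> * g i x.
have Ep : hankel_eigen p.
  by apply: hankel_eigenD => //; apply: hankel_eigenZ; exact: hankel_eigen_sum.
have px : p x != 0 by rewrite /p mulN1r subr_eq0; apply/eqP.
have [c [Ec cc]] := normalize Ep px.
have cp := Ep.1.
have pg j : <<(fun x => c * p x), g j>> = 0.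
  by rewrite dotZl// /p orthonormal_residue ?mulr0//; exact: Ef.1.
pose h (i : 'I_m.+1) := if unlift ord_max i is Some j then g j else fun x => c * p x.
have : P m.+1.
  apply/asboolP; exists h; split=> [i|i j]; rewrite /h.
    by case: unliftP.
  case: unliftP => [i' ->|->]; case: unliftP => [j' ->|->].
  - by rewrite gg (inj_eq lift_inj).
  - by rewrite dotC pg eq_sym (negbTE (neq_lift _ _)).
  - by rewrite pg (negbTE (neq_lift _ _)).
  - by rewrite cc eqxx.
by move=> /mmax; rewrite ltnn.
Qed.

End hankel_eigenspace.

(** Translation multiplies [p + i q] by [al + i be]. Invariance of the mean of [p ^+ 2 + q ^+ 2]
    forces this factor to have modulus 1, and evaluation at 0 expresses it through [p] and [q],
    whence continuity and multiplicativity. *)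
Lemma character_of_rotation (R : realType) (K : topologicalZmodType) (p q : K -> R) :
  compact [set: K] -> continuous p -> continuous q ->
  (exists x, p x ^+ 2 + q x ^+ 2 != 0) ->
  (forall a, exists al be, forall x,
    p (x + a) = al * p x - be * q x /\ q (x + a) = be * p x + al * q x) ->
  exists chi : pdual R K, forall a x,
    p (x + a) = circle_cos (chi a) * p x - circle_sin (chi a) * q x /\
    q (x + a) = circle_sin (chi a) * p x + circle_cos (chi a) * q x.
Proof.
move=> cK cp cq [x1 n1].
have [M] := @invariant_mean_exists R K.
pose n x := p x ^+ 2 + q x ^+ 2.
have nge0 x : 0 <= n x by rewrite addr_ge0// sqr_ge0.
have cn : continuous n by apply: continuous_add; exact: continuous_mul.
move=> /choice[al /choice[be pq]].
have nD a x : n (x + a) = (al a ^+ 2 + be a ^+ 2) * n x.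
  by have [] := pq a x; rewrite /n => -> ->; ring.
have n0 : n 0 != 0.
  apply: contra_neq n1 => n0.
  by have := nD x1 0; rewrite add0r n0 mulr0.
have albe a : al a ^+ 2 + be a ^+ 2 = 1.
  have Mn : 0 < M n by apply: mean_gt0 => //; exists 0; rewrite lt_neqAle eq_sym n0 nge0.
  have bn := compact_bounded_map cK cn.
  have := mean_shift M a bn; under [X in M X]eq_fun do rewrite nD.
  by rewrite meanZ// -[RHS]mul1r => /(mulIf (lt0r_neq0 Mn)).
have alE a : al a = (n 0)^-1 * (p a * p 0 + q a * q 0).
  have [] := pq a 0; rewrite add0r => -> ->; apply: (mulfI n0).
  by rewrite mulrA divff// mul1r /n; ring.
have beE a : be a = (n 0)^-1 * (q a * p 0 - p a * q 0).
  have [] := pq a 0; rewrite add0r => -> ->; apply: (mulfI n0).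
  by rewrite mulrA divff// mul1r /n; ring.
have ccst (c : R) : continuous (fun _ : K => c) by exact: cst_continuous.
have cal : continuous al.
  rewrite (_ : al = fun a => (n 0)^-1 * (p a * p 0 + q a * q 0)); last exact/funext.
  by apply: continuous_mul => //; apply: continuous_add; exact: continuous_mul.
have cbe : continuous be.
  rewrite (_ : be = fun a => (n 0)^-1 * (q a * p 0 + (- q 0) * p a)); last first.
    by apply/funext => a; rewrite beE; congr (_ * _); ring.
  by apply: continuous_mul => //; apply: continuous_add; exact: continuous_mul.
have alD a b : al (a + b) = al a * al b - be a * be b.
  rewrite (alE (a + b)); have [-> ->] := pq b a; rewrite (alE a) (beE a); ring.
have beD a b : be (a + b) = be a * al b + al a * be b.
  rewrite (beE (a + b)); have [-> ->] := pq b a; rewrite (alE a) (beE a); ring.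
have [chi chiE] := character_of_cos_sin cal cbe albe alD beD.
by exists chi => a x; have [-> ->] := chiE a.
Qed.

Section real_eigenvector.
Local Open Scope complex_scope.

(** Over the complex numbers the family has a common eigenvector [c + i s] with eigenvalues
    [al + i be]; the matrices being real, the two parts separate. *)
Lemma commuting_real_eigenvector (R : realType) (I : Type) n (A : I -> 'M[R]_n) :
  (0 < n)%N -> (forall i j, comm_mx (A i) (A j)) ->
  exists c s : 'rV[R]_n, (c != 0) || (s != 0) /\ forall i, exists al be : R,
    c *m A i = al *: c - be *: s /\ s *m A i = be *: c + al *: s.
Proof.
move=> n0 AA; pose B i : 'M[R[i]]_n := map_mx (real_complex R) (A i).
have BB i j : comm_mx (B i) (B j) by rewrite /comm_mx -!map_mxM AA.
have [w w0 wB] := common_eigenvector_family n0 BB.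
exists (map_mx (@complex.Re R) w), (map_mx (@complex.Im R) w); split.
  rewrite -negb_and; apply: contra w0 => /andP[/eqP/rowP c0 /eqP/rowP s0].
  apply/eqP/rowP => j; have := c0 j; have := s0 j; rewrite !mxE.
  by case: (w 0 j) => a b /= -> ->.
move=> i; have [[al be] /rowP wE] := wB i; exists al, be.
have ReD : {morph @complex.Re R : x y / x + y} by case=> [? ?] [? ?].
have ImD : {morph @complex.Im R : x y / x + y} by case=> [? ?] [? ?].
have ReM (z : R[i]) (r : R) : complex.Re (z * r%:C) = complex.Re z * r.
  by case: z => x y /=; rewrite mulr0 subr0.
have ImM (z : R[i]) (r : R) : complex.Im (z * r%:C) = complex.Im z * r.
  by case: z => x y /=; rewrite mulr0 add0r.
split; apply/rowP => j; have := wE j; rewrite !mxE.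
  move=> /(congr1 (@complex.Re R)); rewrite (big_morph _ ReD (erefl : complex.Re 0 = 0)).
  under eq_bigr do rewrite mxE ReM; under [X in _ -> X = _]eq_bigr do rewrite mxE.
  by move=> ->; case: (w 0 j).
move=> /(congr1 (@complex.Im R)); rewrite (big_morph _ ImD (erefl : complex.Im 0 = 0)).
under eq_bigr do rewrite mxE ImM; under [X in _ -> X = _]eq_bigr do rewrite mxE.
by move=> ->; case: (w 0 j) => x y /=; rewrite addrC.
Qed.

End real_eigenvector.

Lemma characters_separate (R : realType) (K : topologicalZmodType) (x0 : K) :
  compact [set: K] -> hausdorff_space K -> x0 != 0 ->
  exists chi : pdual R K, chi x0 != 0.
Proof.
move=> cK hK x00.
have [M] := @invariant_mean_exists R K.
have [u [cu u0x0]] : exists u : K -> R, continuous u /\ u 0 != u x0.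
  have cl x : closed [set x : K] by apply: compact_closed => //; exact: compact_set1.
  have disj : [set (0 : K)] `&` [set x0] = set0.
    by rewrite -subset0 => x [/= -> /esym/eqP]; rewrite (negbTE x00).
  have := (@normal_separatorP R _).1 (compact_normal hK cK) _ _ (cl 0) (cl x0) disj.
  move=> /(@uniform_separatorP _ R)[u [cu _ u0 u1]]; exists u; split => //.
  have -> : u 0 = 0 by apply: u0; exists 0.
  have -> : u x0 = 1 by apply: u1; exists x0.
  by rewrite eq_sym oner_eq0.
pose v x := u x + (-1) * u (x + x0).
have cu1 : continuous (fun x => u (x + x0)) by exact: translate_continuous.
have cv : continuous v.
  apply: continuous_add => //; apply: continuous_mul => //; exact: cst_continuous.
have v0 : v 0 != 0 by rewrite /v add0r mulN1r subr_eq0.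
have [rho [e [rho0 ce e0 Ee]]] := hankel_eigenfunction M cK cv v0.
have [m [g [m0 og gE]]] := hankel_eigen_basis cK cv rho0 (conj ce Ee) e0.
have [Eg gg] := og; have cg i := (Eg i).1.
(* Translation by [a] on the eigenspace, acting on row coordinates; these matrices commute since [K]
   is abelian. *)
pose A a : 'M[R]_m := \matrix_(i, j) dot M (fun x => g i (x + a)) (g j).
have gA i a x : g i (x + a) = \sum_(j < m) A a i j * g j x.
  rewrite (gE (fun x => g i (x + a)))//; last exact: hankel_eigen_shift.
  by apply: eq_bigr => j _; rewrite mxE.
have AD a b : A a *m A b = A (a + b).
  apply/matrixP => i k; rewrite !mxE; under eq_bigr do rewrite [A b _ _]mxE.
  rewrite -dot_suml// => [|j]; last exact: translate_continuous.
  by congr (M _); apply/funext => x; rewrite -gA -addrA [b + a]addrC.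
have AA a b : comm_mx (A a) (A b) by rewrite /comm_mx !AD addrC.
have [c [s [cs0 csA]]] := commuting_real_eigenvector m0 AA.
pose p x := \sum_(i < m) c 0 i * g i x.
pose q x := \sum_(i < m) s 0 i * g i x.
have Ep : hankel_eigen M v rho p by exact: hankel_eigen_sum.
have Eq : hankel_eigen M v rho q by exact: hankel_eigen_sum.
have coordE (w : 'rV[R]_m) j : dot M (fun x => \sum_(i < m) w 0 i * g i x) (g j) = w 0 j.
  rewrite dot_suml//; under eq_bigr do rewrite gg.
  by rewrite (bigD1 j)//= eqxx mulr1 big1 ?addr0// => i ij; rewrite (negbTE ij) mulr0.
have dot0 j : dot M (fun=> 0) (g j) = 0.
  by rewrite /dot; under [X in M X]eq_fun do rewrite mul0r; exact: mean_cst.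
have pq0 : exists x, p x ^+ 2 + q x ^+ 2 != 0.
  apply: contrapT => /forallNP pq0.
  have pq x : p x = 0 /\ q x = 0.
    have /negP := pq0 x; rewrite negbK paddr_eq0 ?sqr_ge0// !sqrf_eq0.
    by move=> /andP[/eqP ? /eqP].
  suff [c0 s0] : c = 0 /\ s = 0 by move: cs0; rewrite c0 s0 eqxx.
  split; apply/rowP => j; rewrite mxE -coordE.
    by rewrite (_ : (fun _ => _) = (fun=> 0)) ?dot0//; apply/funext => x; exact: (pq x).1.
  by rewrite (_ : (fun _ => _) = (fun=> 0)) ?dot0//; apply/funext => x; exact: (pq x).2.
have rowE (w : 'rV[R]_m) a x :
    \sum_(i < m) w 0 i * g i (x + a) = \sum_(j < m) (w *m A a) 0 j * g j x.
  under eq_bigr do rewrite gA mulr_sumr; rewrite exchange_big/=.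
  apply: eq_bigr => j _; rewrite mxE mulr_suml.
  by apply: eq_bigr => i _; rewrite mulrA.
have rot a : exists al be, forall x,
    p (x + a) = al * p x - be * q x /\ q (x + a) = be * p x + al * q x.
  have [al [be [cA sA]]] := csA a; exists al, be => x.
  rewrite /p /q !rowE cA sA !mulr_sumr; split.
    by rewrite -sumrB; apply: eq_bigr => j _; rewrite !mxE; ring.
  by rewrite -big_split; apply: eq_bigr => j _; rewrite !mxE /=; ring.
have [chi chiE] := character_of_rotation cK Ep.1 Eq.1 pq0 rot.
exists chi; apply/eqP => chi0.
have pfix x : p (x + x0) = p x.
  by rewrite (chiE x0 x).1 chi0 circle_cos0 circle_sin0 mul1r mul0r subr0.
have qfix x : q (x + x0) = q x.
  by rewrite (chiE x0 x).2 chi0 circle_cos0 circle_sin0 mul1r mul0r add0r.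
(* When [f] is invariant under [x0], the two terms of [v] give integrands that are translates of one
   another, so their means cancel and [rho * f] is the image of 0. *)
have fix0 f : hankel_eigen M v rho f -> (forall x, f (x + x0) = f x) -> forall z, f z = 0.
  move=> [cf Ef] ffix z.
  have cuf y : continuous (fun x => u (x + y) * f x).
    by apply: continuous_mul => //; exact: translate_continuous.
  have Hf0 : hankel M v f = fun=> 0.
    apply/funext => y; rewrite /hankel.
    have buf := compact_bounded_map cK (cuf y).
    rewrite (_ : (fun x => _) =
        (fun x => u (x + y) * f x - (u (x + x0 + y) * f (x + x0)))).
      rewrite meanB//; last exact: (bounded_map_shift x0 buf).
      by rewrite (mean_shift M x0 buf) subrr.
    apply/funext => x; rewrite /v ffix [y + x]addrC [x + x0 + y]addrAC; ring.
  have := congr1 (@^~ z) Ef; rewrite Hf0 /hankel.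
  under [X in M X]eq_fun do rewrite mulr0.
  by rewrite mean_cst => /esym/eqP; rewrite mulf_eq0 gt_eqF//= => /eqP.
have [x] := pq0; rewrite (fix0 p)// (fix0 q)//.
by rewrite expr0n addr0 eqxx.
Qed.

(** * Kronecker's theorem *)

Section kronecker.
Context {R : realType} {K : topologicalZmodType}.
Hypothesis cK : compact [set: K].

Lemma circle_cos_sub_continuous (chi : pdual R K) t :
  continuous (fun k => circle_cos (chi k - t)).
Proof.
move=> k; apply: (@continuous_comp _ _ _ (fun k => chi k - t) circle_cos).
  apply: (@continuous_comp _ _ _ chi (fun s => s - t)); first exact: pdual_continuous.
  exact: addr_continuous.
exact: circle_cos_continuous.
Qed.

Lemma circle_cos_le1 (t : circle R) : circle_cos t <= 1.
Proof. exact: cos_le1. Qed.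

(** A quarter turn, so that continuity of shifted cosines covers sines. *)
Lemma circle_sin_cos (t : circle R) : circle_sin t = circle_cos (t - circle_pi (4^-1)).
Proof.
have [x <-] := circle_pi_surj t.
rewrite -circle_piB circle_sin_pi circle_cos_pi -cosBpihalf; congr cos.
by rewrite -mulr_natr; field.
Qed.

(** Translation by [a] rotates the vector of the means of cosine and sine by the angle [chi a], and
    invariance leaves it fixed; a nontrivial rotation fixes only 0. *)
Lemma mean_character (M : @invariant_mean R K) (chi : pdual R K) t : chi != 0 ->
  M (fun k => circle_cos (chi k - t)) = 0.
Proof.
move=> chi0; have [a ca] : exists a, chi a != 0.
  apply: contrapT => /forallNP chi1; move/eqP: chi0; apply.
  by apply: pdual_eq => a; have /negP := chi1 a; rewrite negbK => /eqP.
set C := circle_cos (chi a); set S := circle_sin (chi a).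
pose c k := circle_cos (chi k - t).
pose s k := circle_sin (chi k - t).
have cc : continuous c by exact: circle_cos_sub_continuous.
have cs : continuous s.
  rewrite /s; under eq_fun do rewrite circle_sin_cos -addrA -opprD.
  exact: circle_cos_sub_continuous.
have bc := compact_bounded_map cK cc; have bs := compact_bounded_map cK cs.
have Mc : M c = C * M c - S * M s.
  rewrite -{1}(mean_shift M a bc) -!meanZ// -meanB; [|exact: bounded_mapZ..].
  congr (M _); apply/funext => k.
  by rewrite /c /s pdual_add addrAC (circle_cosD _ (chi a)) -/C -/S; ring.
have Ms : M s = S * M c + C * M s.
  rewrite -{1}(mean_shift M a bs) -!meanZ// -meanD; [|exact: bounded_mapZ..].
  congr (M _); apply/funext => k.
  by rewrite /c /s pdual_add addrAC (circle_sinD _ (chi a)) -/C -/S; ring.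
have C1 : C != 1 by apply: contra_neq ca; exact: circle_cos_eq1.
have CS : C ^+ 2 + S ^+ 2 = 1 by exact: circle_cos2Dsin2.
(* [2 * (1 - C)] is the determinant of the identity minus the rotation. *)
have : (2 * (1 - C)) * M c = 0.
  rewrite (_ : 2 * (1 - C) = (1 - C) ^+ 2 + S ^+ 2); last first.
    have -> : S ^+ 2 = 1 - C ^+ 2 by move: CS; lra.
    by ring.
  have e1 : (1 - C) * M c = - S * M s by rewrite mulrBl mul1r mulNr; move: Mc; lra.
  have e2 : (1 - C) * M s = S * M c by rewrite mulrBl mul1r; move: Ms; lra.
  by rewrite mulrDl !expr2 -!mulrA e1 -e2; ring.
by move=> /eqP; rewrite mulf_eq0 mulf_eq0 pnatr_eq0 subr_eq0 (eq_sym 1) (negbTE C1) => /eqP.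
Qed.

(** [J] plays the role of a group of formal integer combinations, so that [chi_p] says that every
    relation among the characters also holds among the values [p]. *)
Variables (J : zmodType) (chi : J -> pdual R K) (p : J -> circle R).
Hypotheses (chiB : {morph chi : x y / x - y}) (pB : {morph p : x y / x - y}).
Hypothesis chi_p : forall j, chi j = 0 -> p j = 0.

(* Trigonometric polynomials paired with their translates by the phases p; the
   paired functions have the same mean, as if p were evaluation at a point. *)
Inductive trig_pair : (K -> R) -> (K -> R) -> Prop :=
| trig_monomial a j : trig_pair (fun k => a * circle_cos (chi j k - p j))
                                (fun k => a * circle_cos (chi j k))
| trig_sum f f0 g g0 : trig_pair f f0 -> trig_pair g g0 ->
    trig_pair (fun k => f k + g k) (fun k => f0 k + g0 k).

Lemma pdualB (c c' : pdual R K) k : (c - c') k = c k - c' k.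
Proof. by []. Qed.

Let chi0 : chi 0 = 0. Proof. by rewrite -(subrr 0) chiB subrr. Qed.
Let p0 : p 0 = 0. Proof. by rewrite -(subrr 0) pB subrr. Qed.
Let chiN j : chi (- j) = - chi j. Proof. by rewrite -[LHS]addr0 -sub0r chiB chi0 addr0 sub0r. Qed.
Let pN j : p (- j) = - p j. Proof. by rewrite -[LHS]addr0 -sub0r pB p0 addr0 sub0r. Qed.
Let chiD i j : chi (i + j) = chi i + chi j. Proof. by rewrite -[j]opprK chiB !chiN !opprK. Qed.
Let pD i j : p (i + j) = p i + p j. Proof. by rewrite -[j]opprK pB !pN !opprK. Qed.

Lemma trig_pair_cst a : trig_pair (fun=> a) (fun=> a).
Proof.
have := trig_monomial a 0; rewrite chi0 p0.
by under eq_fun do rewrite subr0 circle_cos0 mulr1; under [X in trig_pair _ X]eq_fun do rewrite circle_cos0 mulr1.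
Qed.

(** Product-to-sum formula; the phases follow because [chi] and [p] are both additive. *)
Lemma trig_pairM f f0 g g0 : trig_pair f f0 -> trig_pair g g0 ->
  trig_pair (fun k => f k * g k) (fun k => f0 k * g0 k).
Proof.
move=> ff0 gg0; elim: ff0 => {f f0} [a i|f f0 f' f0' _ IH _ IH'].
  elim: gg0 => {g g0} [b j|g g0 g' g0' _ IH _ IH'].
    have := trig_sum (trig_monomial (a * b / 2) (i + j)) (trig_monomial (a * b / 2) (i - j)).
    congr trig_pair; apply/funext => k.
      rewrite chiD chiB pD pB (_ : (chi i + chi j) k - _ = (chi i k - p i) + (chi j k - p j)).
        rewrite (_ : (chi i - chi j) k - _ = (chi i k - p i) - (chi j k - p j)).
          move: (chi i k - p i) (chi j k - p j) => A B.
          by rewrite !circle_cosD circle_cosN circle_sinN; field.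
        by rewrite pdualB !opprD !opprK addrACA.
      by rewrite opprD addrACA.
    rewrite chiD chiB (_ : (chi i + chi j) k = chi i k + chi j k)// pdualB.
    move: (chi i k) (chi j k) => A B.
    by rewrite !circle_cosD circle_cosN circle_sinN; field.
  under eq_fun do rewrite mulrDr; under [X in trig_pair _ X]eq_fun do rewrite mulrDr.
  exact: trig_sum.
under eq_fun do rewrite mulrDl; under [X in trig_pair _ X]eq_fun do rewrite mulrDl.
exact: trig_sum.
Qed.

Lemma trig_pair_continuous f f0 : trig_pair f f0 -> continuous f /\ continuous f0.
Proof.
elim=> {f f0} [a j|f f0 f' f0' _ [cf cf0] _ [cf' cf0']]; last first.
  by split; exact: continuous_add.
split; apply: continuous_mul; try exact: cst_continuous.
  exact: circle_cos_sub_continuous.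
have := @circle_cos_sub_continuous (chi j) 0.
by under eq_fun do rewrite subr0.
Qed.

(** If [chi j = 0] then the phase vanishes and the two monomials agree; otherwise both means are
    0. *)
Lemma trig_pair_mean (M : @invariant_mean R K) f f0 : trig_pair f f0 -> M f = M f0.
Proof.
elim=> {f f0} [a j|f f0 g g0 fP IH gP IH']; last first.
  have [cf cf0] := trig_pair_continuous fP; have [cg cg0] := trig_pair_continuous gP.
  by rewrite !meanD ?IH ?IH'//; exact: compact_bounded_map.
have [c0|c0] := eqVneq (chi j) 0.
  by rewrite (chi_p c0); under eq_fun do rewrite subr0.
have bc t : bounded_map (fun k => circle_cos (chi j k - t)).
  by apply: compact_bounded_map => //; exact: circle_cos_sub_continuous.
rewrite meanZ// mean_character// mulr0.
under eq_fun do rewrite -[chi j _]subr0.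
by rewrite meanZ// mean_character// mulr0.
Qed.

Lemma compact_lt1 (f : K -> R) : continuous f -> (forall k, f k < 1) ->
  exists2 q, 0 <= q < 1 & forall k, f k <= q.
Proof.
move=> cf f1; pose r k := (1 + f k) / 2.
have nV k : nbhs k [set k' | f k' < r k].
  have d0 : 0 < (1 - f k) / 2 by have := f1 k; lra.
  have /cvgrPdist_lt/(_ _ d0) := cf k; apply: filterS => k' /=.
  by rewrite /r ltr_norml => /andP[]; lra.
have [s sP] := compact_finite_cover cK nV.
exists (\big[Num.max/0]_(k <- s) r k).
  apply/andP; split; first exact: bigmax_ge_id.
  by elim/big_ind : _ => // [x y x1 y1|k _]; [rewrite gt_max x1|have := f1 k; rewrite /r; lra].
move=> k; have [k' ks /ltW] := sP k => /le_trans; apply.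
exact: le_bigmax_seq.
Qed.

Lemma trig_pair_exp f f0 n : trig_pair f f0 ->
  trig_pair (fun k => f k ^+ n) (fun k => f0 k ^+ n).
Proof.
move=> ff0; elim: n => [|n IH]; first exact: trig_pair_cst.
under eq_fun do rewrite exprS; under [X in trig_pair _ X]eq_fun do rewrite exprS.
exact: trig_pairM.
Qed.

(* If P < 1 everywhere, where P is the product of the (1 + cos (chi_j - p_j)) / 2,
   then the means of P ^ n decay faster than those of P0 ^ n, where P0 is P with
   phases 0, because P0 0 = 1; but these means are equal. *)
Lemma kronecker_finite (s : seq J) : exists k, forall j, j \in s -> chi j k = p j.
Proof.
apply: contrapT => /forallNP nk.
have [M] := @invariant_mean_exists R K.
(* Each factor lies in [[0, 1]] and equals 1 exactly where [chi j k = p j]. *)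
pose h j k := 2^-1 * (1 + circle_cos (chi j k - p j)).
pose h0 j k := 2^-1 * (1 + circle_cos (chi j k)).
pose P k := \prod_(j <- s) h j k.
pose P0 k := \prod_(j <- s) h0 j k.
have PP0 : trig_pair P P0.
  rewrite /P /P0; elim: (s) => [|j s' IH].
    under eq_fun do rewrite big_nil; under [X in trig_pair _ X]eq_fun do rewrite big_nil.
    exact: trig_pair_cst.
  under eq_fun do rewrite big_cons; under [X in trig_pair _ X]eq_fun do rewrite big_cons.
  apply: trig_pairM => //; rewrite /h /h0.
  under eq_fun do rewrite mulrDr; under [X in trig_pair _ X]eq_fun do rewrite mulrDr.
  by apply: trig_sum; [exact: trig_pair_cst|exact: trig_monomial].
have h01 j k : 0 <= h j k <= 1.
  by have := cos_geN1 (pi *+ 2 * circle_frac (chi j k - p j));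
     have := circle_cos_le1 (chi j k - p j); rewrite /h /circle_cos; lra.
have h001 j k : 0 <= h0 j k.
  by have := cos_geN1 (pi *+ 2 * circle_frac (chi j k)); rewrite /h0 /circle_cos; lra.
have P_ge0 k : 0 <= P k by apply: prodr_ge0 => j _; case/andP: (h01 j k).
have P0_ge0 k : 0 <= P0 k by apply: prodr_ge0 => j _.
have P_lt1 k : P k < 1.
  have /existsNP[j /not_implyP[js jk]] := nk k.
  rewrite /P (big_rem j)//=; apply: (@le_lt_trans _ _ (h j k)).
    apply: ler_piMr; first by case/andP: (h01 j k).
    elim/big_rec : _ => // i x _ x1; case/andP: (h01 i k) => hi0 hi1.
    by rewrite -[leRHS]mulr1; apply: le_trans (ler_wpM2l hi0 x1) _; rewrite ler_wpM2r.
  have : circle_cos (chi j k - p j) != 1.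
    by apply: contra_not_neq jk => /circle_cos_eq1/eqP; rewrite subr_eq0 => /eqP.
  have := circle_cos_le1 (chi j k - p j); rewrite /h le_eqVlt => /predU1P[->|]; first by rewrite eqxx.
  lra.
have [cP cP0] := trig_pair_continuous PP0.
have [q /andP[q0 q1] Pq] := compact_lt1 cP P_lt1.
(* A level strictly between [q] and [P0 0 = 1]. *)
pose r := (1 + q) / 2.
have r0 : 0 < r by rewrite /r; lra.
have P01 : P0 0 = 1.
  rewrite /P0 big1// => j _; rewrite /h0 (_ : chi j 0 = 0) ?circle_cos0; first by field.
  by apply: (addIr (chi j 0)); rewrite -pdual_add !add0r.
(* Twice the positive part of [P0 - r]: continuous, at most 2, and nonzero only where
   [r ^+ n <= P0 ^+ n]. *)
pose phi k := (P0 k - r) + `|P0 k - r|.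
have cphi : continuous phi.
  have cr : continuous (fun k => P0 k - r).
    by apply: continuous_add => //; exact: cst_continuous.
  apply: continuous_add => //.
  by move=> k; apply: (@continuous_comp _ _ _ (fun k => P0 k - r) Num.norm); [exact: cr|exact: norm_continuous].
have Mphi : 0 < M phi.
  apply: mean_gt0 => //; first by move=> k; rewrite /phi; have := ler_norm (- (P0 k - r)); rewrite normrN; lra.
  by exists 0; rewrite /phi P01 ger0_norm /r; lra.
have bphi := compact_bounded_map cK cphi.
have key n : r ^+ n * M phi <= 2 * q ^+ n.
  have PPn := trig_pair_exp n PP0; have [cPn cP0n] := trig_pair_continuous PPn.
  have bPn := compact_bounded_map cK cPn; have bP0n := compact_bounded_map cK cP0n.
  apply: (@le_trans _ _ (2 * M (fun k => P0 k ^+ n))).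
    rewrite -!meanZ//; apply: le_mean => [||k]; [exact: bounded_mapZ..|].
    rewrite /phi; have [Pr|/ltW Pr] := leP r (P0 k).
      rewrite ger0_norm ?subr_ge0// mulrC -mulr2n -[_ *+ 2]mulr_natl -mulrA ler_pM2l//.
      have P01k : P0 k <= 1.
        rewrite /P0; elim/big_rec : _ => // i x _ x1.
        have h0i1 : h0 i k <= 1 by have := circle_cos_le1 (chi i k); rewrite /h0; lra.
        by rewrite -[leRHS]mulr1; apply: le_trans (ler_wpM2l (h001 i k) x1) _; rewrite ler_wpM2r.
      apply: (@le_trans _ _ (1 * r ^+ n)).
        by rewrite ler_wpM2r ?exprn_ge0 ?(ltW r0)//; lra.
      by rewrite mul1r; apply: lerXn2r => //; rewrite nnegrE ?P0_ge0// ltW.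
    rewrite ler0_norm ?subr_le0// subrr mulr0.
    by rewrite mulr_ge0// exprn_ge0.
  rewrite ler_pM2l// -(trig_pair_mean M PPn) -(mean_cst M (q ^+ n)).
  by apply: le_mean => // [|k]; [exact: bounded_map_cst|rewrite lerXn2r// nnegrE].
have qr0 : 0 <= q / r by apply: divr_ge0 => //; exact: ltW.
have qr1 : `|q / r| < 1.
  by rewrite ger0_norm// ltr_pdivrMr// mul1r /r; lra.
have /cvgrPdist_lt/(_ _ (divr_gt0 Mphi (ltr0Sn R 1)))[n _ /(_ n (leqnn n))] := cvg_expr qr1.
rewrite /= sub0r normrN ger0_norm ?exprn_ge0//.
rewrite expr_div_n ltr_pdivrMr ?exprn_gt0// => qn.
have := key n; rewrite leNgt => /negP; apply.
by move: qn; rewrite mulrC; lra.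
Qed.

(** If every [k] failed at some [j k], the failure would persist nearby; by compactness finitely
    many indices would then have no common solution. *)
Lemma kronecker : exists k, forall j, chi j k = p j.
Proof.
apply: contrapT => /forallNP nk.
have /choice[j jP] k : exists j, chi j k != p j.
  by have /existsNP[j /eqP jk] := nk k; exists j.
have nU k : nbhs k [set k' | circle_cos (chi (j k) k' - p (j k)) < 1].
  have lt1 : circle_cos (chi (j k) k - p (j k)) < 1.
    rewrite lt_neqAle circle_cos_le1 andbT; apply: contra_neq (jP k).
    by move=> /circle_cos_eq1/eqP; rewrite subr_eq0 => /eqP.
  have := @circle_cos_sub_continuous (chi (j k)) (p (j k)) k.
  have d0 : 0 < 1 - circle_cos (chi (j k) k - p (j k)) by lra.
  move=> /cvgrPdist_lt/(_ _ d0); apply: filterS => k' /=.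
  by rewrite ltr_norml => /andP[]; lra.
have [s sP] := compact_finite_cover cK nU.
have [k kP] := kronecker_finite [seq j x | x <- s].
have [x xs] := sP k; rewrite /= kP ?map_f//.
by rewrite subrr circle_cos0 ltxx.
Qed.

End kronecker.

(** * Baire sets *)

Lemma measurable_forall_mem (d : measure_display) (T : measurableType d) (I : eqType)
    (s : seq I) (F : I -> set T) : (forall i, measurable (F i)) ->
  measurable [set t | forall i, i \in s -> F i t].
Proof.
move=> mF; elim: s => [|i s IH].
  by rewrite (_ : [set t | _] = setT)//; apply/seteqP; split.
rewrite (_ : [set t | _] = F i `&` [set t | forall j, j \in s -> F j t]).
  exact: measurableI.
apply/seteqP; split=> t.
  by move=> Ft; split=> [|j js]; apply: Ft; rewrite inE ?eqxx ?js ?orbT.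
by move=> [Fi Fs] j; rewrite inE => /predU1P[->|/Fs].
Qed.

Lemma measurable_exists_mem (d : measure_display) (T : measurableType d) (I : eqType)
    (s : seq I) (F : I -> set T) : (forall i, measurable (F i)) ->
  measurable [set t | exists2 i, i \in s & F i t].
Proof.
move=> mF; have := measurable_forall_mem s (fun i => measurableC (mF i)).
move=> /measurableC; congr measurable; apply/seteqP; split=> t /=.
  move=> nF; apply: contrapT => nex; apply: nF => i is_ Fi.
  by apply: nex; exists i.
by move=> [i is_ Fi] /(_ i is_).
Qed.

Lemma near_forall_mem (T : topologicalType) (x : T) (I : eqType) (s : seq I)
    (Q : I -> set T) : (forall i, nbhs x (Q i)) ->
  nbhs x [set y | forall i, i \in s -> Q i y].
Proof.
move=> nQ; elim: s => [|i s IH]; first by apply: filterE.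
apply: filterS2 (nQ i) IH => y Qi Qs j; rewrite inE => /predU1P[->//|]; exact: Qs.
Qed.

Section baire_characters.
Context {R : realType} {K : topologicalZmodType}.
Hypotheses (cK : compact [set: K]) (hK : hausdorff_space K).

Local Notation iota := (@iota_map R K).
Local Notation dual_power := (mpow (pdual R K) (circle R)).

(** Each [y] outside [U] is told apart from [x] by a character, and a lower bound on a shifted
    cosine of it excludes a neighbourhood of [y]; finitely many such bounds exclude the complement
    of [U]. *)
Lemma character_neighborhood (U : set K) (x : K) : open U -> U x ->
  exists F : set dual_power,
    [/\ measurable F, nbhs x (iota @^-1` F) & iota @^-1` F `<=` U].
Proof.
move=> oU Ux.
have /choice[chi chiP] y : exists chi : pdual R K, ~ U y -> chi y != chi x.
  have [->|yx] := eqVneq y x; first by exists 0.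
  have [|chi chiyx] := characters_separate R (x0 := y - x) cK hK; first by rewrite subr_eq0.
  exists chi => _; apply: contra_neq chiyx => chiE.
  by apply: (addIr (chi x)); rewrite -pdual_add subrK add0r.
pose h y t := circle_cos (t - chi y x).
(* Midpoint between the value at [y] and the value 1 taken at [x]. *)
pose c y := (1 + h y (chi y y)) / 2.
have hc y : ~ U y -> h y (chi y y) < c y /\ c y < 1.
  move=> /chiP chiy; suff : h y (chi y y) < 1 by rewrite /c; lra.
  rewrite lt_neqAle circle_cos_le1 andbT; apply: contra_neq chiy.
  by move=> /circle_cos_eq1/eqP; rewrite subr_eq0 => /eqP.
have ch y : continuous (fun z => h y (chi y z)) by exact: circle_cos_sub_continuous.
(* Points of [U] join the cover with [U] itself and impose no condition in [G]. *)
pose V y := [set z | U y /\ U z \/ ~ U y /\ h y (chi y z) < c y].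
have nV y : nbhs y (V y).
  have [Uy|nUy] := pselect (U y).
    by apply: (@filterS _ _ _ U) => [z Uz|]; [left|apply: open_nbhs_nbhs; split].
  have [hy _] := hc _ nUy; have d0 : 0 < c y - h y (chi y y) by rewrite subr_gt0.
  have /cvgrPdist_lt/(_ _ d0) := ch y y; apply: filterS => z /=.
  by rewrite ltr_norml => /andP[? _]; right; split => //; lra.
have [s sP] := compact_finite_cover cK nV.
pose G y : set (circle R) := [set t | ~ U y -> c y < h y t].
have mG y : measurable (G y).
  have [Uy|nUy] := pselect (U y).
    by rewrite (_ : G y = setT)//; apply/seteqP; split=> // t _ /(_ Uy).
  apply: sub_sigma_algebra; rewrite (_ : G y = h y @^-1` [set r | c y < r]).
    have /continuousP : continuous (h y); last by apply; exact: open_gt.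
    move=> t; apply: (@continuous_comp _ _ _ (fun t => t - chi y x) circle_cos).
      exact: addr_continuous.
    exact: circle_cos_continuous.
  by apply/seteqP; split=> t; [move/(_ nUy)|move=> ? _].
exists [set p | forall y, y \in s -> G y (mpow_proj (chi y) p)]; split.
- apply: measurable_forall_mem => y.
  by rewrite -[X in measurable X]setTI; exact: measurable_mpow_proj.
- apply: near_forall_mem => y; have [Uy|nUy] := pselect (U y).
    by apply: filterE => z /(_ Uy).
  have [_ c1] := hc _ nUy; have d0 : 0 < 1 - c y by rewrite subr_gt0.
  have /cvgrPdist_lt/(_ _ d0) := ch y x.
  rewrite /h subrr circle_cos0; apply: filterS => z /=.
  by rewrite ltr_norml => /andP[_ hz] _; rewrite /h /mpow_proj /iota_map; move: hz; lra.
- move=> z Fz; have [y ys [[]//|[nUy hz]]] := sP z.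
  by have := Fz y ys nUy; rewrite /mpow_proj /iota_map => /(lt_trans hz); rewrite ltxx.
Qed.

(** An open set may need uncountably many of the preceding preimages, but the compact set [C] needs
    finitely many, which keeps the union measurable. *)
Lemma character_sandwich (C U : set K) : closed C -> open U -> C `<=` U ->
  exists F : set dual_power,
    [/\ measurable F, C `<=` iota @^-1` F & iota @^-1` F `<=` U].
Proof.
move=> clC oU CU.
have /choice[F FP] x : exists F : set dual_power, [/\ measurable F,
    C x -> nbhs x (iota @^-1` F) & iota @^-1` F `<=` U].
  have [Cx|nCx] := pselect (C x).
    by have [F [mF nF FU]] := character_neighborhood oU (CU _ Cx); exists F.
  by exists set0; split.
pose V x := [set z | C x /\ F x (iota z) \/ ~ C x /\ ~ C z].
have nV x : nbhs x (V x).
  have [_ nF _] := FP x; have [Cx|nCx] := pselect (C x).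
    by apply: filterS (nF Cx) => z Fz; left.
  apply: (@filterS _ _ _ (~` C)) => [z Cz|]; first by right.
  by apply: open_nbhs_nbhs; split => //; exact: closed_openC.
have [s sP] := compact_finite_cover cK nV.
exists [set p | exists2 x, x \in s & F x p]; split.
- by apply: measurable_exists_mem => x; have [] := FP x.
- by move=> z Cz; have [x xs [[_ Fz]|[_ //]]] := sP z; exists x.
- by move=> z [x _ Fz]; have [_ _] := FP x; apply.
Qed.

(** Preimages under [iota] form a sigma-algebra, so the sets [f < a] with [f] continuous suffice.
    Such a set is the countable union of the closed sets [f <= a - n.+1%:R^-1], and between each of
    these and [f < a] there is a preimage. *)
Lemma measurable_preimage_iota (E : set (baire R K)) : measurable E ->
  exists2 F : set dual_power, measurable F & E = iota @^-1` F.
Proof.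
pose G : set (set (baire R K)) := preimage_set_system setT iota measurable.
have sG : sigma_algebra setT G by apply: sigma_algebra_preimage; exact: sigma_algebra_measurable.
suff GE : measurable `<=` G.
  by move=> /GE[F mF <-]; exists F => //; rewrite setTI.
apply: smallest_sub => // _ [f cf [B mB <-]]; rewrite setTI.
suff sub : <<s @RGenInftyO.G R >> `<=` [set B | G (f @^-1` B)].
  have mB' : (@RGenInftyO.G R).-sigma.-measurable B by rewrite -RGenInftyO.measurableE.
  exact: sub mB'.
apply: smallest_sub.
  split.
  - by rewrite /= preimage_set0; case: sG.
  - by move=> A GA; have [_ GC _] := sG; exact: GC GA.
  - by move=> A GA; have [_ _ GU] := sG; rewrite /= preimage_bigcup; exact: GU.
move=> _ [a ->] /=.
have /choice[F FP] n : exists F : set dual_power, [/\ measurable F,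
    [set x : K | f x <= a - n.+1%:R^-1] `<=` iota @^-1` F &
    iota @^-1` F `<=` [set x : K | f x < a]].
  apply: character_sandwich.
  - by have /continuous_closedP/(_ _ (@closed_le R (a - n.+1%:R^-1))) := cf.
  - by have /continuousP/(_ _ (@open_lt R a)) := cf.
  - by move=> x /= /le_lt_trans; apply; rewrite ltrBlDr ltrDl.
exists (\bigcup_n F n); first by apply: bigcup_measurable => n _; have [] := FP n.
rewrite setTI; apply/seteqP; split=> x.
  by move=> [n _ Fx]; have [_ _] := FP n; rewrite /= in_itv/=; apply.
rewrite /= in_itv /= => fxa.
have d0 : 0 < a - f x by rewrite subr_gt0.
exists (Num.truncn (a - f x)^-1) => //; have [_ + _] := FP (Num.truncn (a - f x)^-1).
apply; rewrite /= lerBrDr -lerBrDl invf_ple ?posrE//.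
by apply: ltW; exact: truncnS_gt.
Qed.

End baire_characters.

(** * Integer relations and countable supports *)

Section integer_combinations.
Variables (V : zmodType) (c : nat -> V).

(** Polynomials serve as finitely supported integer sequences: they form an additive group, and a
    countable one, so that relations can be enumerated by [unpickle]. *)
Definition int_comb (m : {poly int}) : V := \sum_(i < size m) c i *~ m`_i.

Lemma int_comb_widen (m : {poly int}) n : (size m <= n)%N -> int_comb m = \sum_(i < n) c i *~ m`_i.
Proof.
move=> mn; rewrite /int_comb (big_ord_widen n (fun i => c i *~ m`_i) mn).
rewrite [RHS](bigID (fun i : 'I_n => (i < size m)%N))/= [X in _ + X]big1 ?addr0//.
by move=> i; rewrite -leqNgt => /(nth_default 0) ->.
Qed.

Lemma int_combB : {morph int_comb : m m' / m - m'}.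
Proof.
move=> m m'; pose n := maxn (size m) (size m').
rewrite !(@int_comb_widen _ n) ?leq_maxl ?leq_maxr//; last first.
  by rewrite (leq_trans (size_polyD _ _))// size_polyN.
by rewrite -sumrB; apply: eq_bigr => i _; rewrite coefB mulrzBr.
Qed.

Lemma int_combXn n : int_comb 'X^n = c n.
Proof.
rewrite (@int_comb_widen _ n.+1) ?size_polyXn// big_ord_recr/= coefXn eqxx big1 ?add0r//.
by move=> i _; rewrite coefXn ltn_eqF.
Qed.

End integer_combinations.

Lemma mpow_countable_support (d : measure_display) (I : Type) (T : measurableType d)
    (i0 : I) (F : set (mpow I T)) : measurable F ->
  exists c : nat -> I, forall p q : mpow I T, (forall n, p (c n) = q (c n)) -> F p -> F q.
Proof.
apply: (smallest_sub (C := sigma_algebra setT) (X := fun F : set (mpow I T) =>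
  exists c : nat -> I, forall p q : mpow I T, (forall n, p (c n) = q (c n)) -> F p -> F q)).
  split.
  - by exists (fun=> i0).
  - move=> A [c cA]; exists c => p q pq [_ nAp]; split => // Aq.
    by apply/nAp/(cA q).
  - move=> A /choice[c cA].
    exists (fun n => if @unpickle (nat * nat)%type n is Some (a, b) then c a b else i0).
    move=> p q pq [n _ Ap]; exists n => //; apply: (cA n p) => // b.
    by have := pq (pickle (n, b)); rewrite pickleK.
move=> _ [i _ [B mB <-]]; exists (fun=> i) => p q pq [_ Bp].
by split => //; rewrite /= -(pq 0%N).
Qed.

(** * Representatives of conditional elements *)

Section measure_algebra_maps.
Context {R : realType} {d : measure_display} {X : measurableType d}.
Variable mu : {measure set X -> \bar R}.

Lemma mcls_ae (A B : msets X) :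
  (\forall x \ae mu, (A : set X) x <-> (B : set X) x) -> mcls mu A = mcls mu B.
Proof.
move=> [N [mN N0 AB]]; apply/mclsP/null_equivP; exists N; split => // x nN.
by apply: contrapT => nAB; apply: nN; exact: AB.
Qed.

Lemma ae_mcls (A B : msets X) : mcls mu A = mcls mu B ->
  \forall x \ae mu, (A : set X) x <-> (B : set X) x.
Proof.
move=> /mclsP/null_equivP[N [mN N0 AB]]; exists N; split => // x /= nAB.
by apply: contrapT => /AB.
Qed.

(** Rational rays separate the values of [circle_frac], and countably many almost sure equivalences
    hold together. *)
Lemma cond_of_ae (f g : {mfun X >-> circle R}) : cond_of mu f = cond_of mu g ->
  \forall x \ae mu, f x = g x.
Proof.
move=> fg.
pose ray (r : R) : msets (circle R) := mset_preimage (@circle_frac R) (MSet (measurable_itv `]-oo, r[)).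
have fgE (E : msets (circle R)) : \forall x \ae mu, (E : set _) (f x) <-> (E : set _) (g x).
  exact: (ae_mcls (congr1 (fun y : cond mu (circle R) => y E) fg)).
have : \forall x \ae mu, forall n, if @unpickle rat n is Some q then
    (ray (ratr q) : set _) (f x) <-> (ray (ratr q) : set _) (g x) else True.
  apply: ae_foralln => n; case: unpickle => [q|]; first exact: fgE.
  exact: nearW.
apply: filterS => x fgx.
have fgq (q : rat) : (circle_frac (f x) < ratr q) = (circle_frac (g x) < ratr q).
  by have := fgx (pickle q); rewrite pickleK /= !in_itv /= => -[fg1 fg2]; apply/idP/idP.
rewrite -[LHS]circle_fracK -[RHS]circle_fracK; congr circle_pi.
have [fgl|fgl|//] := ltgtP (circle_frac (f x)) (circle_frac (g x)).
- have [q] := rat_in_itvoo fgl; rewrite in_itv /= => /andP[fq qg].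
  by have := fgq q; rewrite fq => /esym /(lt_trans qg); rewrite ltxx.
- have [q] := rat_in_itvoo fgl; rewrite in_itv /= => /andP[fq qg].
  by have := fgq q; rewrite fq => /(lt_trans qg); rewrite ltxx.
Qed.

Lemma cond_pair_unique t t' (p : cond mu (circle R * circle R)%type) :
  cond_coords2 p = (t, t') -> cond_pair t t' = p.
Proof. by move=> pE; apply: cond_coords2_inj; rewrite cond_pairE pE. Qed.

(** By uniqueness [cond_pair] is the image of [y] under [(f, g)], so addition is computed
    pointwise. *)
Lemma cond_add_map (d' : measure_display) (Y : measurableType d') (y : cond mu Y)
    (f g h : {mfun Y >-> circle R}) : (forall x, h x = f x + g x) ->
  cond_add (cond_map f y) (cond_map g y) = cond_map h y.
Proof.
move=> hfg; pose k (x : Y) : circle R * circle R := (f x, g x).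
have mk : measurable_fun [set: Y] k by exact: measurable_fun_pair.
pose mkY := isMeasurableFun.Build _ _ _ _ k mk.
pose H : {mfun Y >-> (circle R * circle R)%type} := HB.pack k mkY.
rewrite /cond_add (@cond_pair_unique _ _ (cond_map H y)).
  exact: cond_map_comp.
by congr pair; exact: cond_map_comp.
Qed.

Lemma cond_add_of (f g h : {mfun X >-> circle R}) : (forall x, h x = f x + g x) ->
  cond_add (cond_of mu f) (cond_of mu g) = cond_of mu h.
Proof.
move=> hfg.
(* Every induced element is an image of the one induced by the identity. *)
pose idX : {mfun X >-> X} := HB.pack (@idfun X) (isMeasurableFun.Build _ _ _ _ (@idfun X) (@measurable_id _ X setT)).
have cond_ofE (k : {mfun X >-> circle R}) : cond_of mu k = cond_map k (cond_of mu idX).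
  by apply/cond_eq/funext => E; congr mcls; exact: mset_inj.
by rewrite !cond_ofE; exact: cond_add_map.
Qed.

Section representatives.
Context {K : topologicalZmodType}.
Hypothesis cK : compact [set: K].
Variable f : pdual R K -> {mfun X >-> circle R}.
Hypothesis fD : forall k k', \forall x \ae mu, f (k + k') x = f k x + f k' x.

Lemma representative_int_comb (c : nat -> pdual R K) (m : {poly int}) :
  \forall x \ae mu, f (int_comb c m) x = int_comb (fun i => f (c i) x) m.
Proof.
have f0 : \forall x \ae mu, f 0 x = 0.
  apply: filterS (fD 0 0) => x; rewrite addr0 => f00.
  by apply: (addIr (f 0 x)); rewrite -f00 add0r.
have fN k : \forall x \ae mu, f (- k) x = - f k x.
  apply: filterS2 f0 (fD (- k) k) => x; rewrite addNr => -> fNk.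
  by apply: (addIr (f k x)); rewrite -fNk addNr.
have fn k (n : nat) : \forall x \ae mu, f (k *+ n) x = f k x *+ n.
  elim: n => [|n IH]; first exact: f0.
  by apply: filterS2 IH (fD k (k *+ n)) => x; rewrite !mulrS => -> ->.
have fz k (z : int) : \forall x \ae mu, f (k *~ z) x = f k x *~ z.
  case: z => n; first exact: fn.
  by rewrite NegzE; apply: filterS2 (fn k n.+1) (fN (k *+ n.+1)) => x; rewrite !mulrNz -!pmulrn => <- ->.
rewrite /int_comb; elim: (size m) => [|n IH].
  by apply: filterS f0 => x; rewrite !big_ord0.
by apply: filterS3 IH (fz (c n) m`_n) (fD (\sum_(i < n) c i *~ m`_i) (c n *~ m`_n)) => x;
  rewrite !big_ord_recr/= => -> -> ->.
Qed.

(** Integer relations are countable in number, so one null set serves for all of them; off it, the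
    values satisfy the hypothesis of Kronecker's theorem. *)
Lemma representative_character (c : nat -> pdual R K) :
  \forall x \ae mu, exists k : K, forall n, f (c n) x = c n k.
Proof.
have f0 : \forall x \ae mu, f 0 x = 0.
  apply: filterS (fD 0 0) => x; rewrite addr0 => f00.
  by apply: (addIr (f 0 x)); rewrite -f00 add0r.
have fcomb : \forall x \ae mu, forall n, if @unpickle {poly int} n is Some m then
    f (int_comb c m) x = int_comb (fun i => f (c i) x) m else True.
  apply: ae_foralln => n; case: unpickle => [m|]; last exact: nearW.
  exact: representative_int_comb.
apply: filterS2 f0 fcomb => x f0x fx.
have fm m : f (int_comb c m) x = int_comb (fun i => f (c i) x) m.
  by have := fx (pickle m); rewrite pickleK.
have [m m0|k kP] := kronecker cK (int_combB c) (int_combB (fun i => f (c i) x)).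
  by rewrite -fm m0.
by exists k => n; have := kP 'X^n; rewrite !int_combXn => ->.
Qed.
End representatives.

End measure_algebra_maps.

(** * Image and injectivity of [cond_map iota_map] *)

Theorem theorem3p6 (R : realType) (d : measure_display) (X : measurableType d)
    (mu : {measure set X -> \bar R}) (mu_gt0 : (0 < mu [set: X])%E)
    (K : topologicalZmodType) (K_compact : compact [set: K])
    (K_hausdorff : hausdorff_space K) :
  @cond_coords R d X mu _ (pdual R K) (circle R) @`
    (cond_map (@iota_map R K) @` [set: cond mu (baire R K)])
  = [set theta : pdual R K -> cond mu (circle R) |
      forall khat1 khat2 : pdual R K,
        theta (khat1 + khat2) = cond_add (theta khat1) (theta khat2)]
  /\ injective (cond_map (@iota_map R K) :
       cond mu (baire R K) -> cond mu (mpow (pdual R K) (circle R))).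
Proof.
have preim (E : msets (baire R K)) : exists F : msets (mpow (pdual R K) (circle R)),
    E = mset_preimage (@iota_map R K) F.
  have [F mF EF] := measurable_preimage_iota K_compact K_hausdorff (mset_measurable E).
  by exists (MSet mF); exact: mset_inj.
split; last first.
  move=> y z yz; apply/cond_eq/funext => E; have [F ->] := preim E.
  exact: (congr1 (fun w : cond mu _ => w F) yz).
apply/seteqP; split=> [_ [_ [y _ <-] <-] k k'|theta thetaD].
  pose char (k : pdual R K) : {mfun baire R K >-> circle R} :=
    HB.pack (k : baire R K -> circle R) (isMeasurableFun.Build _ _ _ _ _ (measurable_character k)).
  have coordE i : cond_coords (cond_map (@iota_map R K) y) i = cond_map (char i) y.
    exact: cond_map_comp.
  by rewrite !coordE; apply/esym/cond_add_map.
have /choice[f fE] k := cond_circle_of (theta k).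
have fD k k' : \forall x \ae mu, f (k + k') x = f k x + f k' x.
  pose h x := f k x + f k' x.
  have mh : measurable_fun [set: X] h.
    have mff : measurable_fun [set: X] (fun x => (f k x, f k' x)) by exact: measurable_fun_pair.
    exact: (measurableT_comp (@measurable_circle_add R) mff).
  pose H : {mfun X >-> circle R} := HB.pack h (isMeasurableFun.Build _ _ _ _ h mh).
  have : cond_of mu (f (k + k')) = cond_of mu H.
    by rewrite -fE thetaD !fE; exact: cond_add_of.
  by move=> /cond_of_ae.
pose g (x : X) : mpow (pdual R K) (circle R) := fun k => f k x.
have mg : measurable_fun [set: X] g.
  apply: (@measurability _ _ X (mpow (pdual R K) (circle R)) setT g
    (@cylinders _ (pdual R K) (circle R)) erefl).
  move=> _ [_ [i _ [B mB <-]] <-].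
  have := @measurable_funPT _ _ _ _ (f i) measurableT _ mB.
  by rewrite !setTI.
pose G : {mfun X >-> mpow (pdual R K) (circle R)} := HB.pack g (isMeasurableFun.Build _ _ _ _ g mg).
pose W := cond_of mu G.
(* For almost every [x] some [iota_map k] agrees with [G x] on the supports of both sets, so
   membership of [G x] in either is decided on the range of [iota_map]. *)
have WE (F F' : msets (mpow (pdual R K) (circle R))) :
    mset_preimage (@iota_map R K) F = mset_preimage (@iota_map R K) F' -> W F = W F'.
  move=> FF'.
  have [c cF] := mpow_countable_support 0 (mset_measurable F).
  have [c' cF'] := mpow_countable_support 0 (mset_measurable F').
  have FF'k k : (F : set _) (@iota_map R K k) <-> (F' : set _) (@iota_map R K k).
    by have := congr1 (fun E : msets (baire R K) => (E : set _) k) FF'; rewrite /= /preimage /= => ->.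
  apply: mcls_ae.
  (* One sequence interleaves both supports: odd places carry [c], even ones [c']. *)
  apply: filterS (representative_character K_compact fD
    (fun n => if odd n then c n./2 else c' n./2)) => x [k kP].
  have kc n : G x (c n) = iota_map k (c n).
    by have := kP n.*2.+1; rewrite /= odd_double /= uphalf_double.
  have kc' n : G x (c' n) = iota_map k (c' n).
    by have := kP n.*2; rewrite odd_double doubleK.
  split => [Fx|F'x].
    by apply: (cF' (iota_map k)) => //; apply/FF'k; exact: (cF (G x)).
  by apply: (cF (iota_map k)) => //; apply/FF'k; exact: (cF' (G x)).
have /choice[phi phiE] := preim.
(* [phi] is an arbitrary choice; by [WE] each law of [y] reduces to that of [W], since preimages
   commute with the set operations. *)
pose y (E : msets (baire R K)) := W (phi E).
have y0 : y mset0 = \bot%O.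
  rewrite -(pullback0 W); apply: WE; rewrite -phiE; exact: mset_inj.
have yT : y msetT = \top%O.
  rewrite -(pullbackT W); apply: WE; rewrite -phiE; exact: mset_inj.
have yI E F : y (msetI E F) = Order.meet (y E) (y F).
  rewrite -(pullbackI W); apply: WE; rewrite -phiE {1}(phiE E) {1}(phiE F); exact: mset_inj.
have yU E F : y (msetU E F) = Order.join (y E) (y F).
  rewrite -(pullbackU W); apply: WE; rewrite -phiE {1}(phiE E) {1}(phiE F); exact: mset_inj.
have yC E : y (msetC E) = Order.compl (y E).
  rewrite -(pullbackC W); apply: WE; rewrite -phiE {1}(phiE E); exact: mset_inj.
have y_bigcup (E : nat -> msets (baire R K)) :
    supremums (range (fun n => y (E n))) (y (mset_bigcup E)).
  rewrite (_ : y _ = W (mset_bigcup (fun n => phi (E n)))); first exact: (pullback_bigcup W).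
  apply: WE; rewrite -phiE; apply: mset_inj => /=.
  by rewrite preimage_bigcup; apply: eq_bigcupr => n _; rewrite {1}(phiE (E n)).
exists W; last first.
  by apply/funext => k; rewrite fE; exact: cond_map_of.
exists (Cond y0 yT yI yU yC y_bigcup) => //.
apply/cond_eq/funext => F; apply: WE; exact/esym/phiE.
Qed.
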